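(* Let $\mathcal{E}_{\mathrm{fc}}$ be the infinitely prolonged equation of flat connections in a trivial bundle $\mathcal{U}\times\mathbb{R}^m\to\mathcal{U}$ over a coordinate chart $\mathcal{U}$ with coordinates $x_1,\dots,x_n$. For a vector-function $h=(h^1,\dots,h^m)$, $h^\alpha\in C^\infty(\mathcal{E}_{\mathrm{fc}})$, let $V_h=\sum_\alpha h^\alpha D_{v^\alpha}$ and let $S_h$ be the symmetry of $\mathcal{E}_{\mathrm{fc}}$ with generating section $[\![\bar U_{\mathrm{fc}},V_h]\!]$. Then, under the identification $h\leftrightarrow S_h$ of $m$-dimensional vector-functions on $\mathcal{E}_{\mathrm{fc}}$ with symmetries of $\mathcal{E}_{\mathrm{fc}}$, the commutator of symmetries determines the following bracket on the module of smooth $m$-dimensional vector-functions on $\mathcal{E}_{\mathrm{fc}}$: $$\{f,g\}^\alpha=S_f(g^\alpha)-S_g(f^\alpha)+V_f(g^\alpha)-V_g(f^\alpha),\qquad\alpha=1,\dots,m.$$ For any vector-function $h$ the coefficients of the vector field $S_h=\sum_{|I|>0}S_I^{\alpha,A}\,\partial/\partial v_I^{\alpha,A}$ in the special coordinates $v_I^{\alpha,A}$ can be computed by the formulas $$S_I^{\alpha,A}=D_{v^A}(S_I^{\alpha,\varnothing}),\qquad S_{Ii}^{\alpha,\varnothing}=D_i(S_I^{\alpha,\varnothing})+\sum_{\beta=1}^m v_I^{\alpha,\beta}\zeta_i^\beta,$$ where $\zeta_i^\beta=S_i^{\beta,\varnothing}$ and $\zeta_i^\beta=D_i(h^\beta)-\sum_{\gamma=1}^m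 v_i^{\beta,\gamma}h^\gamma$.
   Context: $\mathcal{E}_{\mathrm{fc}}$ is the infinite prolongation (system plus all differential consequences, inside the infinite jet space) of $$\partial_{x_i}v_j^\alpha+\sum_\beta v_i^\beta\partial_{v^\beta}v_j^\alpha=\partial_{x_j}v_i^\alpha+\sum_\beta v_j^\beta\partial_{v^\beta}v_i^\alpha,\quad 1\le i<j\le n,\ \alpha=1,\dots,m,$$ with independent variables $x_1,\dots,x_n,v^1,\dots,v^m$ and dependent variables $v_i^\alpha$. $C^\infty(\mathcal{E}_{\mathrm{fc}})$ consists of smooth functions depending on finite-order jets. $D_{x_i},D_{v^\alpha}$ are the total derivatives restricted to $\mathcal{E}_{\mathrm{fc}}$, and $D_i=D_{x_i}+\sum_\beta v_i^\beta D_{v^\beta}$; the fields $D_1,\dots,D_n$ commute pairwise. Special coordinates. For (unordered) multi-indices $A=\alpha_1\dots\alpha_l$ ($\alpha_k\in\{1,\dots,m\}$) and $I=i_1\dots i_k$ ($i_j\in\{1,\dots,n\}$) put $D_{v^A}=D_{v^{\alpha_1}}\circ\dots\circ D_{v^{\alpha_l}}$, $D_I=D_{i_1}\circ\dots\circ D_{i_k}$ and $v_I^{\alpha,A}=D_{v^A}D_I(v^\alpha)$ for $|I|>0$. Then $v_i^{\alpha,\varnothing}=v_i^\alpha$, $v_i^{\alpha,\beta}=D_{v^\beta}(v_i^\alpha)$, and $x_i$, $v^\alpha$, $v_I^{\alpha,A}$ ($|I|>0$) are coordinates on $\mathcal{E}_{\mathrm{fc}}$. A symmetry is a vector field $S$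 on $\mathcal{E}_{\mathrm{fc}}$ with $S(x_i)=S(v^\alpha)=0$ commuting with all $D_{x_i},D_{v^\alpha}$. Its generating section is the tuple $\varphi_i^\alpha=S(v_i^\alpha)$, written as $\sum_{i,\alpha}\varphi_i^\alpha\,dx_i\otimes D_{v^\alpha}$; it determines $S$. With $\bar U_{\mathrm{fc}}=\sum_i dx_i\otimes D_i$ and the Frölicher–Nijenhuis bracket, $[\![\bar U_{\mathrm{fc}},V_h]\!]=\sum_i dx_i\otimes[D_i,V_h]=\sum_{i,\alpha}\big(D_i(h^\alpha)-\sum_\beta v_i^{\alpha,\beta}h^\beta\big)dx_i\otimes D_{v^\alpha}$. The correspondence $h\mapsto S_h$ is the identification of $m$-tuples of functions in $C^\infty(\mathcal{E}_{\mathrm{fc}})$ with the symmetries of $\mathcal{E}_{\mathrm{fc}}$ through which the commutator is transferred: the bracket is meant in the sense $[S_f,S_g]=S_{\{f,g\}}$. *)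

(* Defs.v *)
From HB Require Import structures.
From mathcomp Require Import all_boot all_order all_algebra.
From mathcomp Require Import all_classical all_reals all_analysis.

Set Implicit Arguments.
Unset Strict Implicit.
Unset Printing Implicit Defensive.
Import Order.TTheory GRing.Theory Num.Theory.
Import numFieldNormedType.Exports.
Local Open Scope classical_set_scope.
Local Open Scope ring_scope.

(* Unordered multi-indices are multiplicity functions {ffun T -> nat}. *)
Definition midx (T : finType) := {ffun T -> nat}.
Definition msize (T : finType) (s : midx T) : nat := (\sum_t s t)%N.
Definition mnull (T : finType) : midx T := [ffun=> 0%N].
Definition mincr (T : finType) (s : midx T) (t : T) : midx T :=
  [ffun r => (s r + (r == t))%N].

(* The composition of the D t, each iterated s t times; the factors are taken
   in the order of the enumeration of T, which is immaterial as soon as the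
   operators D t commute. *)
Definition mcomp (T : finType) (X : Type) (D : T -> X -> X) (s : midx T)
    : X -> X :=
  \big[(fun F G : X -> X => F \o G)/(@id X)]_(t : T) iter (s t) (D t).

(* Independent variables: inl i stands for x_i, inr a for v^a. *)
Definition base (n m : nat) : Type := ('I_n + 'I_m)%type.

Section SmoothFunctions.
Variables (R : realType) (n m : nat) (U : set 'rV[R]_n) (J : choiceType).

(* The coordinates of a point are the independent variables together with
   (possibly infinitely many) further ones, labelled by J. *)
Definition coordinate : choiceType := (base n m + J)%type.
Definition cspace := {ptws coordinate -> R}.

Definition over_chart : set cspace :=
  [set p | U (\row_i p (inl (inl i)))].

Definition along (p : cspace) (k : coordinate) (t : R) : cspace :=
  fun l => if l == k then t else p l.

Definition partial (k : coordinate) (G : cspace -> R) : cspace -> R :=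
  fun p => derive1 (fun t : R => G (along p k t)) (p k).

Definition depends_on_finitely_many (G : cspace -> R) :=
  exists s : seq coordinate, forall p q, over_chart p -> over_chart q ->
    {in s, p =1 q} -> G p = G q.

(* C^oo functions of finitely many coordinates (on jets: functions of finite
   order, there being finitely many jet coordinates of each order): all
   iterated partial derivatives exist and are continuous.  For functions of
   finitely many coordinates, continuity in the product topology is the usual
   one. *)
Definition smooth (G : cspace -> R) :=
  depends_on_finitely_many G /\
  forall (s : seq coordinate) (p : cspace), over_chart p ->
    {for p, continuous (foldr partial G s)} /\
    forall k : coordinate,
      derivable (fun t : R => foldr partial G s (along p k t)) (p k) 1.

End SmoothFunctions.

Section FlatConnections.
Variables (R : realType) (n m : nat) (U : set 'rV[R]_n).

Local Notation B := (base n m).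

(* (i, a, s) labels the jet coordinate of v_i^a corresponding to the multi-index
   s of differentiations with respect to the independent variables. *)
Definition jetvar : choiceType := ('I_n * 'I_m * midx B)%type.
Definition jets := cspace R n m jetvar.

Definition jbase (b : B) : jets -> R := fun p => p (inl b).
Definition jvar (i : 'I_n) (a : 'I_m) (s : midx B) : jets -> R :=
  fun p => p (inr (i, a, s)).

(* The sum is finitely supported, since G depends on finitely many
   coordinates. *)
Definition jtotal (b : B) (G : jets -> R) : jets -> R :=
  fun p => partial (inl b) G p +
    \sum_(k \in [set: jetvar])
      jvar k.1.1 k.1.2 (mincr k.2 b) p * partial (inr k) G p.

Definition fc_lhs (i j : 'I_n) (a : 'I_m) : jets -> R :=
  fun p => jvar j a (mincr (mnull B) (inl i)) p +
    \sum_b jvar i b (mnull B) p * jvar j a (mincr (mnull B) (inr b)) p.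

Definition fc_eqn (i j : 'I_n) (a : 'I_m) : jets -> R :=
  fun p => fc_lhs i j a p - fc_lhs j i a p.

Definition fc_set : set jets :=
  [set p | over_chart U p /\
    forall (i j : 'I_n) (a : 'I_m) (s : midx B), (i < j)%N ->
      mcomp jtotal s (fc_eqn i j a) p = 0].

Definition Efc : Type := fc_set.
Definition fun_on_E := Efc -> R.
Definition operator := fun_on_E -> fun_on_E.

Definition restr (G : jets -> R) : fun_on_E := fun e => G (val e).

Definition smoothE (g : fun_on_E) :=
  exists G : jets -> R, smooth U G /\ restr G = g.

(* The total derivatives are tangent to the equation, so that the restriction
   of jtotal b G does not depend on the smooth extension G of g. *)
Definition extend (g : fun_on_E) : jets -> R :=
  xget (cst 0) [set G : jets -> R | smooth U G /\ restr G = g].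
Definition totalE (b : B) : operator := fun g => restr (jtotal b (extend g)).

Definition xE (i : 'I_n) : fun_on_E := restr (jbase (inl i)).
Definition vE (a : 'I_m) : fun_on_E := restr (jbase (inr a)).
Definition viE (i : 'I_n) (a : 'I_m) : fun_on_E := restr (jvar i a (mnull B)).

Definition Dx (i : 'I_n) : operator := totalE (inl i).
Definition Dv (a : 'I_m) : operator := totalE (inr a).
Definition D (i : 'I_n) : operator :=
  fun g e => Dx i g e + \sum_b viE i b e * Dv b g e.

(* A vector field on the equation is a field on the jet space along the
   equation, with coefficients c, which is tangent to it: its value on
   restr G depends on restr G only.  Operators are relevant on smooth functions
   only; their values elsewhere are arbitrary. *)
Definition vector_field (X : operator) :=
  exists c : coordinate n m jetvar -> fun_on_E,
    (forall k, smoothE (c k)) /\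
    forall G : jets -> R, smooth U G -> forall e : Efc,
      X (restr G) e =
        \sum_(k \in [set: coordinate n m jetvar]) c k e * partial k G (val e).

Definition commutator (X Y : operator) : operator :=
  fun g e => X (Y g) e - Y (X g) e.

Definition symmetry (S : operator) :=
  [/\ vector_field S,
      forall i, S (xE i) = cst 0,
      forall a, S (vE a) = cst 0 &
      forall (b : B) g, smoothE g -> S (totalE b g) = totalE b (S g)].

(* A vector-valued 1-form is given by its contraction with vector fields. *)
Definition vform := operator -> operator.

(* Froelicher-Nijenhuis bracket of a vector-valued 1-form K with a vector field
   V: [[K, V]] = - L_V K, contracted with X. *)
Definition FN_bracket (K : vform) (V : operator) : vform :=
  fun X g e => commutator (K X) V g e - K (commutator X V) g e.

Definition U_fc : vform := fun X g e => \sum_i X (xE i) e * D i g e.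

Definition section_form (phi : 'I_n -> 'I_m -> fun_on_E) : vform :=
  fun X g e => \sum_i \sum_a phi i a e * X (xE i) e * Dv a g e.

Definition eq_vform (K L : vform) :=
  forall X, vector_field X -> forall g, smoothE g -> K X g = L X g.

Definition generating_section (S : operator) : 'I_n -> 'I_m -> fun_on_E :=
  fun i a => S (viE i a).

Definition vecfun := 'I_m -> fun_on_E.
Definition smooth_vecfun (h : vecfun) := forall a, smoothE (h a).

Definition V_ (h : vecfun) : operator := fun g e => \sum_a h a e * Dv a g e.

Definition is_S_ (h : vecfun) (S : operator) :=
  symmetry S /\
  eq_vform (section_form (generating_section S)) (FN_bracket U_fc (V_ h)).

Definition bracket (Sf Sg : operator) (f g : vecfun) : vecfun :=
  fun a e => Sf (g a) e - Sg (f a) e + V_ f (g a) e - V_ g (f a) e.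

(* v_I^{a,A}; as a coordinate it is considered for |I| > 0 only. *)
Definition v_sp (a : 'I_m) (A : midx 'I_m) (I : midx 'I_n) : fun_on_E :=
  mcomp Dv A (mcomp D I (vE a)).

Definition spvar : choiceType :=
  ('I_m * midx 'I_m * {I : midx 'I_n | (0 < msize I)%N})%type.

Definition v_of (k : spvar) : fun_on_E := v_sp k.1.1 k.1.2 (val k.2).

Definition sp_point (e : Efc) : cspace R n m spvar :=
  fun l => match l with
           | inl b => jbase b (val e)
           | inr k => v_of k e
           end.

(* The partial derivative of g in the special coordinates: g is written as
   G \o sp_point with G smooth, and G is differentiated. *)
Definition sp_partial (k : spvar) : operator := fun g e =>
  partial (inr k)
    (xget (cst 0)
       [set G : cspace R n m spvar -> R | smooth U G /\ G \o sp_point = g])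
    (sp_point e).

End FlatConnections.

(* Main.v *)
From HB Require Import structures.
Require Import Defs.
From mathcomp Require Import all_boot all_order all_algebra.
From mathcomp Require Import all_classical all_reals all_analysis.
From mathcomp Require Import ring.

Set Implicit Arguments.
Unset Strict Implicit.
Unset Printing Implicit Defensive.
Import Order.TTheory GRing.Theory Num.Theory.
Import numFieldNormedType.Exports.
Local Open Scope classical_set_scope.
Local Open Scope ring_scope.
(* The special coordinates identify the equation with a space W on which they
   are free.  On W, D_{v^b} shifts the index A, and D_{x_i} is forced by
   [D_{x_i}, D_{v^b}] = 0 and D_i v_I^a = v_{Ii}^a; the commutator
   [D_i, D_j] = [D_{x_i}, D_{x_j}] commutes with every D_{v^b} and kills x, v and
   v_I^a, hence vanishes.  That a point of the equation is determined by its
   special coordinates is seen by computing in jets modulo the differential ideal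
   of the equation.

   The field Y_h = S_h + V_h commutes with every D_i and maps v^a to h^a, so that
   Y_h v_I^a = D_I h^a.  As S_h also commutes with the D_{v^b}, this determines S_h,
   and conversely it defines S_h.  Since [Y_f, Y_g] = [S_f, S_g] + V_{f,g} again
   commutes with every D_i, [S_f, S_g] is the symmetry of {f,g}.

   If S_h = 0 and n > 0, then D_i h^a = sum_b v_i^{a,b} h^b.  The left-hand side
   depends on v_{Ii}^{c,A}, of an order |Ii| which does not occur on the right, as
   soon as h depends on v_I^{c,A}; hence h is a function of x and v, and comparing
   the coefficients of v_i^{a,b} gives h^b = 0. *)

(** The structure [coordRing] separates analysis from algebra: it asks only for commuting partial
    derivatives, dual to the coordinates, of which each element has finitely many nonzero ones. The
    analytic part has to show that smooth functions form such a ring and that coordinate changes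
    obey the chain rule. The obstacle is that there are infinitely many coordinates and that
    smoothness is given by iterated partial derivatives alone; so the chain rule, the symmetry of
    second derivatives and closure under composition are obtained one coordinate at a time from the
    mean value theorem.

    The passage between jets and W is not symmetric. On W all total derivatives commute identically,
    so that reading jets in special coordinates ([psi]) respects them exactly. On free jets the D_i
    commute only modulo the equation, so that the reverse passage ([sig]) respects them only modulo
    the differential ideal.

    The operators on the equation are defined through arbitrarily chosen smooth extensions; that the
    choice is immaterial follows from the bijection with W.

    For n = 0 there are no coordinates v_I^{a,A} and every S_h vanishes, whence the restriction n >
    0 in the uniqueness of the bracket. *)

(** * Multi-indices and iterated operators *)

Section MultiIndexComposition.
Variable T : finType.

Lemma mcompE (X : Type) (D : T -> X -> X) (s : midx T) :
  mcomp D s = foldr (fun t F => iter (s t) (D t) \o F) id (index_enum T).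
Proof. by rewrite /mcomp unlock. Qed.

(** A relation instead of a map, because the same induction serves morphisms, agreement of functions
    on the chart, and congruence modulo the differential ideal. *)
Lemma mcomp_rel (X Y : Type) (D : T -> X -> X) (D' : T -> Y -> Y)
    (rel : X -> Y -> Prop) :
  (forall t x y, rel x y -> rel (D t x) (D' t y)) ->
  forall s x y, rel x y -> rel (mcomp D s x) (mcomp D' s y).
Proof.
move=> H s x y xy; rewrite !mcompE.
elim: index_enum => //= t r IH.
by elim: (s t) => //= k IHk; exact: H.
Qed.

Lemma mcomp_morph (X Y : Type) (D : T -> X -> X) (D' : T -> Y -> Y) (phi : X -> Y) :
  (forall t x, phi (D t x) = D' t (phi x)) ->
  forall s x, phi (mcomp D s x) = mcomp D' s (phi x).
Proof.
move=> H s x; apply: (mcomp_rel (rel := fun x y => phi x = y)) => //.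
by move=> t u _ <-.
Qed.

Lemma mcomp0 (X : Type) (D : T -> X -> X) x : mcomp D (mnull T) x = x.
Proof.
rewrite mcompE; elim: index_enum => //= t r ->.
by rewrite /mnull ffunE.
Qed.

(** The additional factor [D t] is moved outwards past the factors that precede [t] in the
    enumeration. Commutation up to [rel] is what the fields [jdd i] on jets offer, with [rel] the
    congruence [cong]. *)
Lemma mcompS_rel (X : Type) (D : T -> X -> X) (rel : X -> X -> Prop) :
  (forall x, rel x x) -> (forall x y z, rel x y -> rel y z -> rel x z) ->
  (forall t x y, rel x y -> rel (D t x) (D t y)) ->
  (forall t u x, rel (D t (D u x)) (D u (D t x))) ->
  forall s t x, rel (mcomp D (mincr s t) x) (D t (mcomp D s x)).
Proof.
move=> rel_refl rel_trans relD DC s t x; rewrite !mcompE.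
have : t \in index_enum T by rewrite mem_index_enum.
have : uniq (index_enum T) := index_enum_uniq T.
have rel_iter k u y z : rel y z -> rel (iter k (D u) y) (iter k (D u) z).
  by move=> yz; elim: k => //= k; exact: relD.
have iterC k u v y : rel (iter k (D u) (D v y)) (D v (iter k (D u) y)).
  elim: k => //= k IH; apply: rel_trans (DC _ _ _); exact: relD.
elim: index_enum => //= u r IH /andP[ur uniqr]; rewrite in_cons.
case: eqP => [-> _|/eqP ut /= tr].
  rewrite /mincr ffunE eqxx addn1 /=; apply: (relD); apply: (rel_iter).
  elim: r ur {IH uniqr} => //= v r IH; rewrite in_cons negb_or => /andP[uv ur].
  rewrite ffunE eq_sym (negbTE uv) addn0; apply: (rel_iter); exact: IH.
rewrite {1}/mincr ffunE eq_sym (negbTE ut) addn0.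
by apply: rel_trans (iterC _ _ _ _); apply: rel_iter; exact: IH.
Qed.

Lemma mcompS (X : Type) (D : T -> X -> X) :
  (forall t u x, D t (D u x) = D u (D t x)) ->
  forall s t x, mcomp D (mincr s t) x = D t (mcomp D s x).
Proof.
move=> DC; apply: mcompS_rel => //; first by move=> x y z -> ->.
by move=> t x y ->.
Qed.

(** All other factors are iterated zero times, so that no commutation enters; this makes it
    applicable to [jdd]. *)
Lemma mcomp1 (X : Type) (D : T -> X -> X) t x : mcomp D (mincr (mnull T) t) x = D t x.
Proof.
rewrite mcompE.
have : t \in index_enum T by rewrite mem_index_enum.
have : uniq (index_enum T) := index_enum_uniq T.
elim: index_enum => //= u r IH /andP[ur uniqr]; rewrite in_cons !ffunE.
case: eqP => [-> _|/eqP ut /= tr].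
  rewrite eqxx /=; congr (D u _); elim: r ur {IH uniqr} => //= v r IH.
  rewrite in_cons negb_or => /andP[uv ur].
  by rewrite !ffunE eq_sym (negbTE uv) /= IH.
by rewrite eq_sym (negbTE ut) /=; exact: IH.
Qed.

Lemma midx_ind (P : midx T -> Prop) :
  P (mnull T) -> (forall s t, P s -> P (mincr s t)) -> forall s, P s.
Proof.
move=> P0 PS s; have [k] := ubnP (msize s).
elim: k s => // k IH s; rewrite ltnS => sk.
have [/eqP s0|] := posnP (msize s).
  suff -> : s = mnull T by [].
  apply/ffunP => t; rewrite ffunE; apply/eqP; move: s0.
  by rewrite sum_nat_eq0 => /forallP /(_ t).
rewrite lt0n sum_nat_eq0 negb_forall => /existsP[t]; rewrite implyTb -lt0n => st.
pose s' : midx T := [ffun r => s r - (r == t)]%N.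
have sE : s = mincr s' t.
  apply/ffunP => r; rewrite !ffunE subnK //.
  by case: eqP => // ->.
rewrite sE; apply: PS; apply: IH; apply: leq_trans sk.
rewrite /msize (bigD1 t) //= [X in (_ < X)%N](bigD1 t) //= !ffunE eqxx.
apply: (@leq_ltn_trans (s t - 1 + \sum_(i | i != t) s i)%N).
  by rewrite leq_add2l; apply: leq_sum => i it; rewrite ffunE (negbTE it) subn0.
by rewrite ltn_add2r subn1 prednK.
Qed.

Lemma msize_incr s (t : T) : msize (mincr s t) = (msize s).+1.
Proof.
rewrite /msize /mincr; under eq_bigr do rewrite ffunE.
rewrite big_split /= [X in (_ + X)%N](bigD1 t) //= eqxx.
by rewrite [X in (_ + (_ + X))%N]big1 ?addn0 ?addn1 // => i /negbTE ->.
Qed.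

Lemma msize0 : msize (mnull T) = 0%N.
Proof. by rewrite /msize big1 // => t _; rewrite ffunE. Qed.

Lemma mincrC s (t u : T) : mincr (mincr s t) u = mincr (mincr s u) t.
Proof. by apply/ffunP => r; rewrite !ffunE addnAC. Qed.

End MultiIndexComposition.
(** * Smooth functions of finitely many coordinates *)

Section ChartAnalysis.
Variables (R : realType) (n m : nat) (U : set 'rV[R]_n) (openU : open U).
Variable J : choiceType.
Local Notation coord := (coordinate n m J).
Local Notation cs := (cspace R n m J).
Local Notation chart := (@over_chart R n m U J).
Implicit Types (p q r : cs) (k l : coord) (G : cs -> R).

Lemma cspace_cvg (F : set_system cs) {FF : Filter F} p :
  (forall l, (fun q : cs => q l) @ F --> p l) -> F --> p.
Proof.
move=> H; apply/cvg_sup => l; apply/cvg_image.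
  by rewrite eqEsubset; split=> v // _; exists (cst v).
move=> A /= nA; have := H l _ nA; rewrite nbhs_simpl /= => FA.
exists ((fun q : cs => q l) @^-1` A) => //.
by rewrite eqEsubset; split=> [x [q Aq <-]//|x Ax]; exists (cst x).
Qed.

Lemma coordinate_cvg l p : (fun q : cs => q l) @ nbhs p --> p l.
Proof. exact: (@proj_continuous _ (fun=> R) l p). Qed.

(** An explicit box in the x-coordinates, the only ones that the chart constrains: it keeps the
    intermediate points of the mean value theorem inside the chart. *)
Definition chart_close (e : R) p r :=
  forall i : 'I_n, `|r (inl (inl i)) - p (inl (inl i))| < e.

Lemma chart_open_close p : chart p ->
  exists2 e : R, 0 < e & forall r, chart_close e p r -> chart r.
Proof.
move=> Up; have := open_nbhs_nbhs (conj openU Up).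
move/nbhs_ballP => [e /= e0 eU]; exists e => // r H; apply: eU.
rewrite /ball /=; split => // i j; rewrite !mxE /ball /= distrC; exact: H.
Qed.

Lemma near_chart_close T (F : set_system T) {FF : Filter F} (rho : T -> cs) p e :
  0 < e -> rho @ F --> p -> \forall t \near F, chart_close e p (rho t).
Proof.
move=> e0 H; apply: filter_forall => i.
have /= := cvg_comp _ _ H (@coordinate_cvg (inl (inl i)) p).
by move/cvgrPdist_lt => /(_ e e0); apply: filterS => t /=; rewrite distrC.
Qed.

Lemma near_chart T (F : set_system T) {FF : Filter F} (rho : T -> cs) p :
  chart p -> rho @ F --> p -> \forall t \near F, chart (rho t).
Proof.
move=> /chart_open_close [e e0 H] /(near_chart_close e0).
by apply: filterS => t; exact: H.
Qed.

Lemma along_id p k : along p k (p k) = p.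
Proof. by apply/funext => l; rewrite /along; case: eqP => [->|]. Qed.

Lemma along_at p k t : along p k t k = t.
Proof. by rewrite /along eqxx. Qed.

Lemma along_neq p k t l : l != k -> along p k t l = p l.
Proof. by rewrite /along => /negbTE ->. Qed.

Lemma along_along p k s t : along (along p k s) k t = along p k t.
Proof. by apply/funext => l; rewrite /along; case: eqP. Qed.

Lemma alongC p k l s t : k != l ->
  along (along p k s) l t = along (along p l t) k s.
Proof.
by move=> kl; apply/funext => j; rewrite /along; case: eqP => // ->; rewrite eq_sym (negbTE kl).
Qed.

Lemma along_cvg T (F : set_system T) {FF : Filter F} (rho : T -> cs) (a : T -> R)
    p k : rho @ F --> p -> a @ F --> p k ->
  (fun t => along (rho t) k (a t)) @ F --> p.
Proof.
move=> H Ha; apply: cspace_cvg => l.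
change ((fun t => along (rho t) k (a t) l) @ F --> p l).
rewrite /along; case: (eqVneq l k) => [->//|_].
exact: (cvg_comp _ _ H (@coordinate_cvg l p)).
Qed.

Lemma along_cvg1 p k : along p k @ nbhs (p k) --> p.
Proof. by apply: (@along_cvg _ _ _ (cst p) id); [exact: cvg_cst|exact: cvg_id]. Qed.

Lemma near_chart_along p k : chart p -> \forall t \near p k, chart (along p k t).
Proof. by move=> cp; exact: near_chart cp (@along_cvg1 p k). Qed.

Lemma eq_partial G G' k p : chart p ->
  (forall q, chart q -> G q = G' q) -> partial k G p = partial k G' p.
Proof.
move=> cp H; rewrite /partial !derive1E; apply: near_eq_derive.
by apply: filterS (near_chart_along k cp) => t; exact: H.
Qed.

Lemma smooth_is_derive G k p : smooth U G -> chart p ->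
  is_derive (p k) 1 (fun t : R => G (along p k t)) (partial k G p).
Proof.
move=> [_ /(_ [::] p)] + cp => /(_ cp)[_ /(_ k)] /= H.
by split => //; rewrite -derive1E.
Qed.

Lemma smooth_is_derive_along G k p t : smooth U G -> chart (along p k t) ->
  is_derive t 1 (fun s : R => G (along p k s)) (partial k G (along p k t)).
Proof.
move=> sG /(smooth_is_derive k sG); rewrite along_at.
by under eq_fun do rewrite along_along.
Qed.

Lemma smooth_continuous G p : smooth U G -> chart p -> G @ nbhs p --> G p.
Proof. by move=> [_ /(_ [::] p)] + cp => /(_ cp)[]. Qed.

End ChartAnalysis.

(** Phrased by distances to [a], since the increments to which it is applied have no definite
    sign. *)
Lemma MVT_between (R : realType) (f df : R -> R) (a b : R) :
  (forall x, `|x - a| <= `|b - a| -> is_derive x 1 f (df x)) ->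
  exists2 c, `|c - a| <= `|b - a| & f b - f a = df c * (b - a).
Proof.
move=> H.
have [ab|ba] := leP a b.
  have Hx x : x \in `[a, b] -> `|x - a| <= `|b - a|.
    by rewrite in_itv /= => /andP[ax xb]; rewrite !ger0_norm ?subr_ge0 // lerB.
  have [||c ci ->] := @MVT_segment R f df a b ab.
  - by move=> x /subset_itv_oo_cc xi; exact/H/Hx.
  - by apply: derivable_within_continuous => x xi; have [] := H _ (Hx _ xi).
  - by exists c => //; exact: Hx.
have Hx x : x \in `[b, a] -> `|x - a| <= `|b - a|.
  rewrite in_itv /= => /andP[ax xb]; rewrite !ler0_norm ?subr_le0 //; last exact: ltW.
  by rewrite lerN2 lerB.
have [||c ci E] := @MVT_segment R f df b a (ltW ba).
- by move=> x /subset_itv_oo_cc xi; exact/H/Hx.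
- by apply: derivable_within_continuous => x xi; have [] := H _ (Hx _ xi).
- by exists c; [exact: Hx|rewrite -opprB E -mulrN opprB].
Qed.
(** As [g t0 = 0], the difference quotient of the product is [phi] times that of [g]; a limit of
    [phi] replaces its derivative. *)
Lemma is_derive_cvg_mul (R : realType) (phi g : R -> R) (t0 c d : R) :
  phi @ nbhs t0 --> c -> is_derive t0 1 g d -> g t0 = 0 ->
  is_derive t0 1 (fun t => phi t * g t) (c * d).
Proof.
move=> Hphi [dg Eg] g0.
have Hs : (fun h : R => phi (h + t0)) @ 0^' --> c.
  apply: cvg_comp Hphi; apply: cvg_trans (_ : (fun h : R => h + t0) @ nbhs 0 --> t0).
    by apply: cvg_app; exact: nbhs_dnbhs.
  by rewrite -[X in _ --> X]add0r; apply: cvgD; [exact: cvg_id|exact: cvg_cst].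
suff H : (fun h : R => h^-1 *: (((fun t => phi t * g t) \o shift t0) (h *: 1) -
    phi t0 * g t0)) @ 0^' --> c * d.
  by split; [apply/cvg_ex; exists (c * d)|apply: (cvg_lim _ H)].
have Hg : (fun h : R => h^-1 * (g (h + t0) - g t0)) @ 0^' --> d.
  rewrite -Eg; move: dg; rewrite /derivable /derive => dg.
  apply: cvg_trans dg; apply: near_eq_cvg; near=> h.
  by rewrite /= /GRing.scale /= mulr1.
apply: cvg_trans (cvgM Hs Hg); apply: near_eq_cvg.
near=> h; rewrite /= g0 /GRing.scale /= mulr1 mulr0 !subr0 /=; ring.
Unshelve. all: by end_near. Qed.

(** * The chain rule along a curve *)

Section Chain.
Variables (R : realType) (n m : nat) (U : set 'rV[R]_n) (openU : open U).
Variable J : choiceType.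
Local Notation coord := (coordinate n m J).
Local Notation cs := (cspace R n m J).
Local Notation chart := (@over_chart R n m U J).
Implicit Types (p q r : cs) (k l : coord) (G : cs -> R).

(** Iterated derivatives of [partial k G] are iterated derivatives of [G]. The point is that the
    same finite set [s] of coordinates serves: for [k] in [s] the two lines in direction [k] agree
    on [s], otherwise the derivative is 0. *)
Lemma smooth_partial G k : smooth U G -> smooth U (partial k G).
Proof.
move=> [[s Hs] H]; split; last first.
  move=> w p cp; have := H (rcons w k) p cp.
  by rewrite -cats1 foldr_cat.
exists s => p q cp cq E; rewrite /partial.
have [ks|ks] := boolP (k \in s).
  rewrite (E _ ks) !derive1E; apply: near_eq_derive.
  have np : \forall t \near q k, chart (along p k t).
    by rewrite -(E _ ks); exact: near_chart_along.
  have nq := near_chart_along openU k cq.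
  near=> t; apply: Hs.
  - by near: t.
  - by near: t.
  - by move=> l ls; rewrite /along; case: eqP => // _; exact: E.
have aux r : chart r -> derive1 (fun t : R => G (along r k t)) (r k) = 0.
  move=> cr; rewrite derive1E -(@derive_cst R R R (G r) (r k) 1).
  apply: near_eq_derive; near=> t; apply: Hs => //.
    by near: t; exact: near_chart_along.
  by move=> l ls; rewrite along_neq //; apply: contraNN ks => /eqP <-.
by rewrite !aux.
Unshelve. all: by end_near. Qed.

(** By the mean value theorem [phi t] is the partial derivative at a point between [rho t] and its
    displacement; these points tend to [p], where [partial l G] is continuous. The base point
    [rho t] may move, as the telescoping in [chain_curve] requires. *)
Lemma slope_cvg G l p T (F : set_system T) {FF : Filter F} (rho : T -> cs)
    (a : T -> R) : smooth U G -> chart p -> rho @ F --> p -> a @ F --> p l ->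
  exists2 phi : T -> R, phi @ F --> partial l G p &
    \forall t \near F,
      G (along (rho t) l (a t)) - G (rho t) = phi t * (a t - rho t l).
Proof.
move=> sG cp Hr Ha.
have [e e0 He] := chart_open_close openU cp.
have Hrl : (fun t => rho t l) @ F --> p l.
  exact: (cvg_comp _ _ Hr (@coordinate_cvg _ _ _ _ l p)).
have Hd : (fun t => `|a t - rho t l| + `|rho t l - p l|) @ F --> (0 : R).
  rewrite -[X in _ --> X](addr0 0).
  apply: cvgD; apply/norm_cvg0P.
    by rewrite -(subrr (p l)); apply: cvgB.
  by rewrite -(subrr (p l)); apply: cvgB => //; exact: cvg_cst.
pose good t := forall x, `|x - rho t l| <= `|a t - rho t l| ->
  chart (along (rho t) l x).
have Hgood : \forall t \near F, good t.
  have H1 := near_chart_close e0 Hr.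
  have H2 : \forall t \near F, `|a t - rho t l| + `|rho t l - p l| < e.
    move/cvgrPdist_lt : Hd => /(_ e e0); apply: filterS => t.
    by rewrite sub0r normrN ger0_norm // addr_ge0.
  near=> t => x Hx.
  have Ht : chart_close e p (rho t) by near: t; exact: H1.
  apply: He => i; rewrite /along; case: eqP => [E|_].
    rewrite E; apply: le_lt_trans (ler_distD (rho t l) _ _) _.
    apply: (@le_lt_trans _ _ (`|a t - rho t l| + `|rho t l - p l|)).
      by rewrite lerD2r.
    by near: t.
  exact: Ht.
(* Where the segment leaves the chart, the default [rho t l] keeps the distance bound, so that [c]
   converges along all of [F]. *)
have /choice[c Hc] : forall t, exists c, `|c - rho t l| <= `|a t - rho t l| /\
   (good t -> G (along (rho t) l (a t)) - G (rho t) =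
     partial l G (along (rho t) l c) * (a t - rho t l)).
  move=> t; have [gt|ngt] := pselect (good t); last first.
    by exists (rho t l); rewrite subrr normr0; split.
  have [|c Hc E] := @MVT_between R (fun x => G (along (rho t) l x))
      (fun x => partial l G (along (rho t) l x)) (rho t l) (a t).
    by move=> x /gt; exact: smooth_is_derive_along.
  by exists c; split => // _; rewrite -E along_id.
exists (fun t => partial l G (along (rho t) l (c t))); last first.
  by apply: filterS Hgood => t /(proj2 (Hc t)).
have Hcl : c @ F --> p l.
  apply/subr_cvg0/norm_cvg0P.
  have Z : (fun _ : T => 0 : R) @ F --> (0 : R) by exact: cvg_cst.
  apply: (squeeze_cvgr _ Z Hd).
  near=> t; rewrite normr_ge0 /=; apply: le_trans (ler_distD (rho t l) _ _) _.
  by rewrite lerD2r; case: (Hc t).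
exact: (cvg_comp _ _ (along_cvg Hr Hcl) (smooth_continuous (smooth_partial l sG) cp)).
Unshelve. all: by end_near. Qed.

Lemma smooth_supp G : smooth U G -> exists2 s : seq coord, uniq s &
  (forall p q, chart p -> chart q -> {in s, p =1 q} -> G p = G q).
Proof.
by move=> [[s Hs] _]; exists (undup s); [exact: undup_uniq|];
  move=> p q cp cq E; apply: Hs => // k ks; apply: E; rewrite mem_undup.
Qed.

Lemma partial_eq0 G (s : seq coord) k p :
  (forall p q, chart p -> chart q -> {in s, p =1 q} -> G p = G q) ->
  chart p -> k \notin s -> partial k G p = 0.
Proof.
move=> Hs cp ks.
rewrite /partial derive1E -(@derive_cst R R R (G p) (p k) 1).
apply: near_eq_derive; near=> t; apply: Hs => //.
  by near: t; exact: near_chart_along.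
by move=> l ls; rewrite along_neq //; apply: contraNN ks => /eqP <-.
Unshelve. all: by end_near. Qed.

(** Telescoping: the coordinates in [s] are switched one after the other from [gam t0] to [gam t],
    each switch contributing one term by [slope_cvg]. Having switched all of [s], [G] cannot tell
    the point from [gam t]. *)
Lemma chain_curve G (gam : R -> cs) (t0 : R) (d : coord -> R) (s : seq coord) :
  smooth U G -> uniq s ->
  (forall p q, chart p -> chart q -> {in s, p =1 q} -> G p = G q) ->
  gam @ nbhs t0 --> gam t0 -> chart (gam t0) ->
  (forall l, l \in s -> is_derive t0 1 (fun t => gam t l) (d l)) ->
  is_derive t0 1 (G \o gam) (\sum_(l <- s) partial l G (gam t0) * d l).
Proof.
move=> sG us Hs cg cg0 Hd.
pose rho s' t : cs := foldr (fun l r => along r l (gam t l)) (gam t0) s'.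
have rhoE s' t l : rho s' t l = if l \in s' then gam t l else gam t0 l.
  elim: s' => //= k s' IH; rewrite /along in_cons.
  by case: eqP => [->//|_]; rewrite IH.
have rho_cvg s' : rho s' @ nbhs t0 --> gam t0.
  elim: s' => [|l s' IH] /=; first exact: cvg_cst.
  apply: along_cvg => //.
  exact: (cvg_comp _ _ cg (@coordinate_cvg _ _ _ _ l (gam t0))).
have main s' : uniq s' -> {subset s' <= s} ->
    is_derive t0 1 (G \o rho s') (\sum_(l <- s') partial l G (gam t0) * d l).
  elim: s' => [_ _|l s' IH /= /andP[ls' us'] sub].
    by rewrite big_nil; exact: (is_derive_cst (G (gam t0))).
  have {}IH := IH us' (fun k ks => sub k (mem_behead (s:=l::s') ks)).
  rewrite big_cons addrC.
  have Hl : (fun t => gam t l) @ nbhs t0 --> gam t0 l.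
    exact: (cvg_comp _ _ cg (@coordinate_cvg _ _ _ _ l (gam t0))).
  have [phi Hphi E] := slope_cvg sG cg0 (rho_cvg s') Hl.
  apply: (@near_eq_is_derive _ _ _
    (fun t => (G \o rho s') t + phi t * (gam t l - gam t0 l))).
    apply: filterS E => t; rewrite rhoE (negbTE ls') => <-.
    by rewrite /= addrC subrK.
  have Hg : is_derive t0 1 (fun t => gam t l - gam t0 l) (d l).
    rewrite -[d l]subr0; have Hdl := Hd l (sub l (mem_head _ _)).
    exact: (is_deriveB Hdl (is_derive_cst (gam t0 l) t0 1)).
  exact: (is_deriveD IH (is_derive_cvg_mul Hphi Hg (subrr _))).
apply: (near_eq_is_derive _ (main s us (fun=> id))).
near=> t; apply: Hs.
- by near: t; exact: (near_chart openU cg0 (rho_cvg s)).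
- by near: t; exact: (near_chart openU cg0 cg).
- by move=> l ls; rewrite rhoE ls.
Unshelve. all: by end_near. Qed.

End Chain.

(** * Symmetry of second derivatives and a criterion for smoothness *)

Section SmoothClosure.
Variables (R : realType) (n m : nat) (U : set 'rV[R]_n) (openU : open U).
Variable J : choiceType.
Local Notation coord := (coordinate n m J).
Local Notation cs := (cspace R n m J).
Local Notation chart := (@over_chart R n m U J).
Implicit Types (p q r : cs) (k l : coord) (G : cs -> R).

(** The mean value theorem is applied twice to the mixed second difference: in direction [k] to the
    difference of two translates of [G], then in direction [l] to [partial k G]. *)
Lemma clairaut_slope G k l p : smooth U G -> chart p -> k != l ->
  exists2 psi : R -> R, psi @ 0^' --> partial l (partial k G) p &
    \forall u \near 0^',
      G (along (along p k (p k + u)) l (p l + u)) - G (along p k (p k + u))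
      - G (along p l (p l + u)) + G p = u * u * psi u.
Proof.
move=> sG cp kl.
have [e e0 He] := chart_open_close openU cp.
pose pt a b := along (along p k a) l b.
have ptE a b j : pt a b j = if j == l then b else if j == k then a else p j.
  by [].
have ptc a b (u : R) : `|u| < e -> `|a - p k| <= `|u| -> `|b - p l| <= `|u| ->
    chart (pt a b).
  move=> ue ak bl; apply: He => i; rewrite ptE.
  case: eqP => [->|_]; first exact: le_lt_trans ue.
  case: eqP => [->|_]; first exact: le_lt_trans ue.
  by rewrite subrr normr0.
have pt0 a : pt a (p l) = along p k a.
  by apply/funext => j; rewrite ptE /along; case: eqP => // ->; rewrite eq_sym (negbTE kl).
have /choice[c Hc] : forall u, exists c : R * R,
    [/\ `|c.1 - p k| <= `|u|, `|c.2 - p l| <= `|u| & `|u| < e ->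
    G (pt (p k + u) (p l + u)) - G (pt (p k + u) (p l))
      - G (pt (p k) (p l + u)) + G (pt (p k) (p l)) =
    u * u * partial l (partial k G) (pt c.1 c.2)].
  move=> u; have [ue|] := ltP `|u| e; last first.
    by exists (p k, p l) => /=; rewrite !subrr !normr0.
  have ku : `|(p k + u) - p k| = `|u| by rewrite addrC addKr.
  have lu : `|(p l + u) - p l| = `|u| by rewrite addrC addKr.
  have [|c1 Hc1 E1] := @MVT_between R (fun a => G (pt a (p l + u)) - G (pt a (p l)))
      (fun a => partial k G (pt a (p l + u)) - partial k G (pt a (p l)))
      (p k) (p k + u).
    have dG b x : `|b - p l| <= `|u| -> `|x - p k| <= `|u| ->
        is_derive x 1 (fun a => G (pt a b)) (partial k G (pt x b)).
      move=> bu xu;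
      have ptC a : pt a b = along (along p l b) k a by rewrite /pt alongC.
      rewrite ptC (_ : (fun a => _) = (fun a => G (along (along p l b) k a))).
        by apply: (smooth_is_derive_along sG); rewrite -ptC; exact: ptc bu.
      by apply/funext => a; rewrite ptC.
    move=> x; rewrite ku => xu; apply: is_deriveB.
      by apply: dG => //; rewrite lu.
    by apply: dG => //; rewrite subrr normr0.
  have [|c2 Hc2 E2] := @MVT_between R (fun b => partial k G (pt c1 b))
      (fun b => partial l (partial k G) (pt c1 b)) (p l) (p l + u).
    move=> x; rewrite lu => xu; rewrite ku in Hc1.
    apply: (smooth_is_derive_along (smooth_partial openU k sG)).
    exact: ptc ue Hc1 xu.
  rewrite ku in Hc1; rewrite lu in Hc2.
  exists (c1, c2); split => //= _.
  move: E1; rewrite E2 => E1.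
  transitivity (G (pt (p k + u) (p l + u)) - G (pt (p k + u) (p l)) -
    (G (pt (p k) (p l + u)) - G (pt (p k) (p l)))); first by ring.
  by rewrite E1; ring.
exists (fun u => partial l (partial k G) (pt (c u).1 (c u).2)).
  have Hu : (fun u : R => `|u|) @ 0^' --> (0 : R).
    apply/cvgrPdist_lt => e' e'0; near=> u; rewrite sub0r normrN normr_id.
    by near: u; exact: dnbhs0_lt.
  have Z : (fun _ : R => 0 : R) @ 0^' --> (0 : R) by exact: cvg_cst.
  have C1 : (fun u => (c u).1) @ 0^' --> p k.
    apply/subr_cvg0/norm_cvg0P; apply: (squeeze_cvgr _ Z Hu).
    by near=> u; rewrite normr_ge0 /=; case: (Hc u).
  have C2 : (fun u => (c u).2) @ 0^' --> p l.
    apply/subr_cvg0/norm_cvg0P; apply: (squeeze_cvgr _ Z Hu).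
    by near=> u; rewrite normr_ge0 /=; case: (Hc u).
  have cp0 : (fun _ : R => p) @ 0^' --> p by exact: cvg_cst.
  have Cpt : (fun u => pt (c u).1 (c u).2) @ 0^' --> p.
    by apply: along_cvg C2; exact: along_cvg cp0 C1.
  have sk : smooth U (partial l (partial k G)).
    exact: (smooth_partial openU l (smooth_partial openU k sG)).
  exact: (cvg_comp _ _ Cpt (smooth_continuous sk cp)).
near=> u.
have ue : `|u| < e by near: u; exact: dnbhs0_lt.
have [_ _ /(_ ue) <-] := Hc u.
by rewrite !pt0 along_id /pt along_id.
Unshelve. all: by end_near. Qed.

(** The mixed second difference is symmetric in [k] and [l]; both orders of differentiation are thus
    limits of the same quotient. *)
Lemma clairaut G k l p : smooth U G -> chart p ->
  partial l (partial k G) p = partial k (partial l G) p.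
Proof.
move=> sG cp; have [->//|kl] := eqVneq k l.
have [psi Hpsi E] := clairaut_slope sG cp kl.
have lk : l != k by rewrite eq_sym.
have [psi' Hpsi' E'] := clairaut_slope sG cp lk.
apply: (cvg_unique (@Rhausdorff R) Hpsi).
apply: cvg_trans Hpsi'; apply: near_eq_cvg.
have nz : \forall u \near (0 : R)^', u != 0 by exact: nbhs_dnbhs_neq.
apply: filterS3 nz E E' => u u0 E1 E2.
apply: (@mulfI _ (u * u)); first by rewrite mulf_neq0.
by rewrite -E1 -E2 alongC //; ring.
Qed.

Lemma eq_continuous_chart G G' p : chart p -> (forall q, chart q -> G q = G' q) ->
  G @ nbhs p --> G p -> {for p, continuous G'}.
Proof.
move=> cp E H.
have N : \forall q \near p, G q = G' q.
  have C : \forall q \near p, chart q.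
    have FF : Filter (nbhs p) by exact: nbhs_filter.
    by apply: (@near_chart R n m U openU J _ (nbhs p) FF id p cp); exact: cvg_id.
  by apply: filterS C => q cq; rewrite E.
rewrite /prop_for /continuous_at -(E _ cp).
exact: cvg_trans (near_eq_cvg N) H.
Qed.

(** A coinductive criterion: all iterated derivatives are controlled at once if a class of
    continuous functions contains, up to values outside the chart, the derivatives of its
    members. *)
Lemma smooth_closed (Q : (cs -> R) -> Prop) :
  (forall G, Q G -> depends_on_finitely_many U G) ->
  (forall G p, Q G -> chart p -> {for p, continuous G}) ->
  (forall G k, Q G -> exists2 G', Q G' & forall p, chart p ->
     is_derive (p k) 1 (fun t : R => G (along p k t)) (G' p)) ->
  forall G, Q G -> smooth U G.
Proof.
move=> Qfin Qcont Qder G QG; split; first exact: Qfin.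
move=> s p cp.
have [G' QG' E] : exists2 G', Q G' & forall q, chart q -> G' q = foldr (@partial R n m J) G s q.
  elim: s => [|k s [G' QG' E]] /=; first by exists G.
  have [G'' QG'' H] := Qder _ k QG'.
  exists G'' => // q cq; rewrite -(eq_partial openU k cq E).
  by rewrite /partial derive1E; have [_ ->] := H _ cq.
split.
  exact: eq_continuous_chart cp E (Qcont _ _ QG' cp).
move=> k; have [G'' _ /(_ p cp)[H _]] := Qder _ k QG'.
apply: near_eq_derivable H.
by apply: filterS (near_chart_along openU k cp) => t; exact: E.
Qed.

Lemma smooth_cst_coord G : (exists c, G = cst c) \/ (exists k, G = fun p => p k) ->
  smooth U G.
Proof.
move: G; apply: smooth_closed.
- move=> G [[c ->]|[k ->]]; first by exists [::].
  by exists [:: k] => p q _ _; apply; rewrite mem_head.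
- move=> G p [[c ->]|[k ->]] cp.
    have H : (fun _ : cs => c) @ nbhs p --> c by exact: cvg_cst.
    exact: H.
  exact: (@coordinate_cvg _ _ _ _ k p).
- move=> G k [[c ->]|[l ->]].
    by exists (cst 0); [left; exists 0|move=> p cp; exact: (is_derive_cst c)].
  exists (cst (k == l)%:R); first by left; eexists.
  move=> p cp; have [->|kl] := eqVneq k l.
    rewrite (_ : (fun t => _) = id); first exact: is_derive_id.
    by apply/funext => t; rewrite along_at.
  rewrite (_ : (fun t => _) = cst (p l)); first exact: (is_derive_cst (p l)).
  by apply/funext => t; rewrite along_neq // eq_sym.
Qed.

Lemma smooth_cst c : smooth U (cst c : cs -> R).
Proof. by apply: smooth_cst_coord; left; exists c. Qed.

Lemma smooth_coord k : smooth U (fun p : cs => p k).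
Proof. by apply: smooth_cst_coord; right; exists k. Qed.

End SmoothClosure.

(** * Smoothness of composites, sums and products *)

Section SmoothComposition.
Variables (R : realType) (n m : nat) (U : set 'rV[R]_n) (openU : open U).
Variables J J' : choiceType.
Local Notation coord := (coordinate n m J).
Local Notation cs := (cspace R n m J).
Local Notation coord' := (coordinate n m J').
Local Notation cs' := (cspace R n m J').
Local Notation chart := (@over_chart R n m U J).
Local Notation chart' := (@over_chart R n m U J').

Variable y : coord' -> cs -> R.
Hypothesis ysmooth : forall l, smooth U (y l).
Hypothesis ybase : forall (i : 'I_n) p, chart p -> y (inl (inl i)) p = p (inl (inl i)).

Definition point_map (p : cs) : cs' := fun l => y l p.

Lemma point_map_chart p : chart p -> chart' (point_map p).
Proof.
move=> cp; rewrite /over_chart /=; have := cp; rewrite /over_chart /=.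
by congr U; apply/rowP => i; rewrite !mxE /point_map ybase.
Qed.

Lemma chain_rule G (s : seq coord') k p : smooth U G -> uniq s ->
  (forall p q, chart' p -> chart' q -> {in s, p =1 q} -> G p = G q) ->
  chart p -> is_derive (p k) 1 (fun t : R => G (point_map (along p k t)))
    (\sum_(l <- s) partial l G (point_map p) * partial k (y l) p).
Proof.
move=> sG us Hs cp.
have := @chain_curve R n m U openU J' G (fun t => point_map (along p k t)) (p k)
  (fun l => partial k (y l) p) s sG us Hs.
rewrite along_id; apply.
- apply: cspace_cvg => l.
  exact: (cvg_comp _ _ (@along_cvg1 R n m J p k) (smooth_continuous (ysmooth l) cp)).
- exact: point_map_chart.
- by move=> l _; exact: smooth_is_derive.
Qed.

Inductive gen_smooth : (cs -> R) -> Prop :=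
| gen_base H : smooth U H -> gen_smooth H
| gen_comp G : smooth U G -> gen_smooth (fun p => G (point_map p))
| gen_add F H : gen_smooth F -> gen_smooth H -> gen_smooth (fun p => F p + H p)
| gen_mul F H : gen_smooth F -> gen_smooth H -> gen_smooth (fun p => F p * H p).

Lemma gen_sum (I : Type) (r : seq I) (F : I -> cs -> R) :
  (forall i, gen_smooth (F i)) -> gen_smooth (fun p => \sum_(i <- r) F i p).
Proof.
move=> H; elim: r => [|i r IH].
  under eq_fun do rewrite big_nil; exact/gen_base/smooth_cst.
under eq_fun do rewrite big_cons; exact: gen_add.
Qed.

Lemma gen_smooth_smooth G : gen_smooth G -> smooth U G.
Proof.
move: G; apply: smooth_closed => //.
- move=> G; elim => {G} [H []//|G [[s Hs] _]|F H _ [s1 H1] _ [s2 H2]|F H _ [s1 H1] _ [s2 H2]].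
  + have /choice[f Hf] : forall l : coord', exists s : seq coord, forall p q, chart p -> chart q ->
      {in s, p =1 q} -> y l p = y l q by move=> l; have [] := ysmooth l.
    exists (flatten [seq f l | l <- s]) => p q cp cq E.
    apply: Hs; try exact: point_map_chart.
    move=> l ls; apply: Hf => // k kf; apply: E; apply/flattenP.
    by exists (f l) => //; exact: map_f.
  + exists (s1 ++ s2) => p q cp cq E.
    by congr (_ + _); [apply: H1|apply: H2] => // k ks;
      apply: E; rewrite mem_cat ks ?orbT.
  + exists (s1 ++ s2) => p q cp cq E.
    by congr (_ * _); [apply: H1|apply: H2] => // k ks;
      apply: E; rewrite mem_cat ks ?orbT.
- move=> G p gG cp; rewrite /prop_for /continuous_at.
  elim: gG => {G} [H sH|G sG|F H _ IF _ IH|F H _ IF _ IH].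
  + exact: smooth_continuous sH cp.
  + have C : point_map @ nbhs p --> point_map p.
      by apply: cspace_cvg => l; exact: smooth_continuous (ysmooth l) cp.
    exact: (cvg_comp _ _ C (smooth_continuous sG (point_map_chart cp))).
  + exact: (cvgD IF IH).
  + exact: (cvgM IF IH).
- move=> G k gG.
  elim: gG => {G} [H sH|G sG|F H gF [F' gF' IF] gH [H' gH' IH]|F H gF [F' gF' IF] gH [H' gH' IH]].
  + exists (partial k H); first exact: (gen_base (smooth_partial openU k sH)).
    by move=> p cp; exact: (smooth_is_derive k sH cp).
  + have [s us Hs] := smooth_supp sG.
    exists (fun p => \sum_(l <- s) partial l G (point_map p) * partial k (y l) p).
      apply: gen_sum => l; apply: gen_mul.
        by apply: (@gen_comp (partial l G)); exact: (smooth_partial openU).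
      by apply: gen_base; exact: (smooth_partial openU).
    by move=> p cp; exact: (chain_rule k sG us Hs cp).
  + exists (fun p => F' p + H' p); first exact: gen_add.
    by move=> p cp; exact: (is_deriveD (IF p cp) (IH p cp)).
  + exists (fun p => F p * H' p + H p * F' p); first by apply: gen_add; exact: gen_mul.
    move=> p cp; have D := is_deriveM (IF p cp) (IH p cp).
    rewrite along_id in D; exact: D.
Qed.

Lemma smooth_comp G : smooth U G -> smooth U (fun p => G (point_map p)).
Proof. by move=> sG; exact/gen_smooth_smooth/gen_comp. Qed.

End SmoothComposition.

Section SmoothRing.
Variables (R : realType) (n m : nat) (U : set 'rV[R]_n) (openU : open U).
Variable J : choiceType.
Local Notation cs := (cspace R n m J).
Implicit Types (G H : cs -> R).

Let coord_smooth l : smooth U (fun p : cs => p l) := smooth_coord openU l.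

(** Case of the closure above in which the functions [y] are the coordinates themselves. *)
Lemma smoothD G H : smooth U G -> smooth U H -> smooth U (fun p => G p + H p).
Proof.
move=> sG sH; apply: (gen_smooth_smooth openU coord_smooth) => //.
by apply: gen_add; exact: gen_base.
Qed.

Lemma smoothM G H : smooth U G -> smooth U H -> smooth U (fun p => G p * H p).
Proof.
move=> sG sH; apply: (gen_smooth_smooth openU coord_smooth) => //.
by apply: gen_mul; exact: gen_base.
Qed.

End SmoothRing.
(** * Vector fields in coordinates *)

(** The coordinates are not assumed to generate the ring, as polynomials do not exhaust the smooth
    functions. An abstract derivation is therefore not known to be determined by its values on
    coordinates; the predicate [field] below singles out those that are. *)
Record coordRing (K : choiceType) := CoordRing {
  cr_sort :> comPzRingType;
  cz : K -> cr_sort;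
  pd : K -> cr_sort -> cr_sort;
  pd_zmod_morphism : forall k, zmod_morphism (pd k);
  pdM : forall k f g, pd k (f * g) = pd k f * g + f * pd k g;
  pd_cz : forall k l, pd k (cz l) = (k == l)%:R;
  pdC : forall k l f, pd k (pd l f) = pd l (pd k f);
  pd_supp : forall f, exists s : seq K, forall k, k \notin s -> pd k f = 0
}.

Arguments cz {K} c k : simpl never.
Arguments pd {K c} k f : simpl never.

Section Fields.
Variables (K : choiceType) (A : coordRing K).
Implicit Types (f g : A) (k l : K) (X Y : A -> A) (c d : K -> A).

HB.instance Definition _ k := GRing.isZmodMorphism.Build A A (pd k) (pd_zmod_morphism k).

Definition supp f : seq K := undup (projT1 (cid (pd_supp f))).

Lemma supp_uniq f : uniq (supp f). Proof. exact: undup_uniq. Qed.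

Lemma suppP f k : k \notin supp f -> pd k f = 0.
Proof. by rewrite mem_undup; exact: (projT2 (cid (pd_supp f))). Qed.

(* Locked, so that a derivation of a sum is not unified with a sum. *)
Fact fld_key : unit. Proof. by []. Qed.
Definition fld : (K -> A) -> A -> A :=
  locked_with fld_key (fun c f => \sum_(k <- supp f) c k * pd k f).

Lemma fld_supp c f : fld c f = \sum_(k <- supp f) c k * pd k f.
Proof. by rewrite /fld unlock. Qed.

Lemma big_uniq_support (V : nmodType) (F : K -> V) (s s' : seq K) :
  uniq s -> uniq s' -> (forall k, k \notin s -> F k = 0) ->
  (forall k, k \notin s' -> F k = 0) -> \sum_(k <- s) F k = \sum_(k <- s') F k.
Proof.
move=> us us' H H'.
rewrite (bigID (mem s')) /= [X in _ + X]big1 ?addr0; last by move=> k; exact: H'.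
rewrite [RHS](bigID (mem s)) /= [X in _ = _ + X]big1 ?addr0; last by move=> k; exact: H.
rewrite -big_filter -[RHS]big_filter; apply: perm_big; apply: uniq_perm.
- exact: filter_uniq.
- exact: filter_uniq.
- by move=> k; rewrite !mem_filter andbC.
Qed.

Lemma fldE c f (s : seq K) : uniq s -> (forall k, k \notin s -> pd k f = 0) ->
  fld c f = \sum_(k <- s) c k * pd k f.
Proof.
move=> us H; rewrite fld_supp; apply: big_uniq_support => //; first exact: supp_uniq.
- by move=> k /suppP ->; rewrite mulr0.
- by move=> k /H ->; rewrite mulr0.
Qed.

(** A common finite index set makes the sums for several elements comparable term by term. *)
Lemma fld_common (fs : seq A) : exists2 s : seq K, uniq s &
  forall f, f \in fs -> forall c, fld c f = \sum_(k <- s) c k * pd k f.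
Proof.
exists (undup (flatten [seq supp f | f <- fs])); first exact: undup_uniq.
move=> f ffs c; apply: fldE; first exact: undup_uniq.
move=> k; rewrite mem_undup => H; apply: suppP; apply: contra H => kf.
by apply/flattenP; exists (supp f) => //; exact: map_f.
Qed.

Lemma fld_cz c k : fld c (cz A k) = c k.
Proof.
rewrite (@fldE _ _ [:: k]) //; first by rewrite big_seq1 pd_cz eqxx mulr1.
by move=> l; rewrite inE pd_cz => /negbTE ->.
Qed.

Lemma fld_zmod_morphism c : zmod_morphism (fld c).
Proof.
move=> f g; have [s us H] := fld_common [:: f; g; f - g].
rewrite !H ?inE ?eqxx ?orbT // -sumrB.
by apply: eq_bigr => k _; rewrite raddfB mulrBr.
Qed.

HB.instance Definition _ c := GRing.isZmodMorphism.Build A A (fld c) (fld_zmod_morphism c).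

Lemma fldM c f g : fld c (f * g) = fld c f * g + f * fld c g.
Proof.
have [s us H] := fld_common [:: f; g; f * g].
rewrite !H ?inE ?eqxx ?orbT // mulr_suml mulr_sumr -big_split.
by apply: eq_bigr => k _ /=; rewrite pdM; ring.
Qed.

Definition field X := forall f, X f = fld (fun k => X (cz A k)) f.

Lemma eq_fld c d f : c =1 d -> fld c f = fld d f.
Proof. by move=> E; rewrite !fld_supp; apply: eq_bigr => k _; rewrite E. Qed.

Lemma fld_field c : field (fld c).
Proof. by move=> f; apply: eq_fld => k; rewrite fld_cz. Qed.

Lemma field_eq X Y : field X -> field Y -> (forall k, X (cz A k) = Y (cz A k)) ->
  forall f, X f = Y f.
Proof. by move=> fX fY E f; rewrite fX fY; exact: eq_fld. Qed.

Lemma field0 : field (fun=> 0).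
Proof. by move=> f; rewrite fld_supp big1 // => k _; rewrite mul0r. Qed.

Lemma field_eq0 X : field X -> (forall k, X (cz A k) = 0) -> forall f, X f = 0.
Proof. by move=> fX; exact: (field_eq fX field0). Qed.

Lemma fieldB X f g : field X -> X (f - g) = X f - X g.
Proof. by move=> fX; rewrite (fX (f - g)) (fX f) (fX g); exact: raddfB. Qed.

Lemma fieldD X f g : field X -> X (f + g) = X f + X g.
Proof. by move=> fX; rewrite (fX (f + g)) (fX f) (fX g); exact: raddfD. Qed.

Lemma field0r X : field X -> X 0 = 0.
Proof. by move=> fX; rewrite (fX 0); exact: raddf0. Qed.

Lemma field_sumr X (I : Type) (r : seq I) (P : pred I) (F : I -> A) : field X ->
  X (\sum_(i <- r | P i) F i) = \sum_(i <- r | P i) X (F i).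
Proof.
move=> fX; apply: (big_morph X) => [f g|]; first exact: fieldD.
exact: field0r.
Qed.

Lemma fieldM X f g : field X -> X (f * g) = X f * g + f * X g.
Proof. by move=> fX; rewrite (fX (f * g)) (fX f) (fX g); exact: fldM. Qed.

Lemma field1 X : field X -> X 1 = 0.
Proof.
move=> fX; have := fieldM 1 1 fX; rewrite !mulr1 mul1r => E.
by apply: (addrI (X 1)); rewrite addr0.
Qed.

Lemma field_bool X (b : bool) : field X -> X b%:R = 0.
Proof. by move=> fX; case: b; [exact: field1|exact: field0r]. Qed.

Lemma pd_field k : field (pd k).
Proof.
move=> f; rewrite (@fldE _ _ (undup (k :: supp f))); first last.
- move=> l; rewrite mem_undup in_cons negb_or => /andP[_]; exact: suppP.
- exact: undup_uniq.
rewrite (bigD1_seq k) ?undup_uniq ?mem_undup ?mem_head //=.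
rewrite pd_cz eqxx mul1r big1 ?addr0 // => l lk.
by rewrite pd_cz eq_sym (negbTE lk) mul0r.
Qed.

Lemma field_lincomb (I : Type) (r : seq I) (a : I -> A) (Z : I -> A -> A) :
  (forall i, field (Z i)) -> field (fun f => \sum_(i <- r) a i * Z i f).
Proof.
move=> fZ f; rewrite fld_supp.
under [RHS]eq_bigr do rewrite mulr_suml.
rewrite exchange_big /=; apply: eq_bigr => i _.
rewrite [in LHS]fZ fld_supp mulr_sumr; apply: eq_bigr => k _; ring.
Qed.

Lemma field_add X Y : field X -> field Y -> field (fun f => X f + Y f).
Proof.
move=> fX fY f; rewrite fX fY !fld_supp -big_split; apply: eq_bigr => k _ /=.
by rewrite mulrDl.
Qed.

Definition bracketA X Y f := X (Y f) - Y (X f).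

Lemma fld_common2 f : exists2 s : seq K, uniq s &
  (forall c, fld c f = \sum_(k <- s) c k * pd k f) /\
  forall c k, fld c (pd k f) = \sum_(l <- s) c l * pd l (pd k f).
Proof.
have [s us H] := fld_common (f :: [seq pd k f | k <- supp f]).
exists s => //; split=> [c|c k]; first by rewrite H ?mem_head.
have [ks|/suppP ->] := boolP (k \in supp f).
  by apply: H; rewrite in_cons; apply/orP; right; apply/mapP; exists k.
by rewrite raddf0 big1 // => l _; rewrite raddf0 mulr0.
Qed.

(* The second order terms cancel because the partial derivatives commute. *)
Lemma field_bracket X Y : field X -> field Y -> field (bracketA X Y).
Proof.
move=> fX fY f; have [s us [H1 H2]] := fld_common2 f.
have E Z W : field Z -> field W -> Z (W f) =
    \sum_(k <- s) Z (W (cz A k)) * pd k f +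
    \sum_(k <- s) \sum_(l <- s) W (cz A k) * Z (cz A l) * pd l (pd k f).
  move=> fZ fW; rewrite [W f]fW H1 field_sumr // -big_split; apply: eq_bigr => k _.
  rewrite fieldM // [Z (pd k f)]fZ H2 mulr_sumr; congr (_ + _).
  by apply: eq_bigr => l _; rewrite mulrA.
rewrite /bracketA H1 (E X Y fX fY) (E Y X fY fX).
rewrite [X in _ - (_ + X)]exchange_big /=.
rewrite [X in _ - (_ + X)](_ : _ =
  \sum_(k <- s) \sum_(l <- s) Y (cz A k) * X (cz A l) * pd l (pd k f)).
  rewrite opprD addrACA subrr addr0 -sumrB.
  by apply: eq_bigr => k _; rewrite mulrBl.
by apply: eq_bigr => k _; apply: eq_bigr => l _; rewrite pdC (mulrC (X _)).
Qed.

Section HorizontalFields.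
Variables (m : nat) (Y : 'I_m -> A -> A).
Hypothesis Yfield : forall b, field (Y b).
Hypothesis YC : forall b b' f, Y b (Y b' f) = Y b' (Y b f).

Definition hfield X (w : 'I_m -> A) f := X f + \sum_b w b * Y b f.

Lemma hfield_field X w : field X -> field (hfield X w).
Proof. by move=> fX; apply: field_add => //; exact: field_lincomb. Qed.

Lemma hfield2 X X' w w' f : field X -> (forall b f, X (Y b f) = Y b (X f)) -> field X' ->
  (forall b f, X' (Y b f) = Y b (X' f)) ->
  hfield X w (hfield X' w' f) = X (X' f) +
  (\sum_c w c * X' (Y c f) + \sum_c w' c * X (Y c f)) +
  \sum_c hfield X w (w' c) * Y c f +
  \sum_b \sum_c w' b * w c * Y c (Y b f).
Proof.
move=> fX XY fX' XY'; have fh := hfield_field w fX.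
rewrite [hfield X' w' f]/hfield (fieldD _ _ fh) (field_sumr _ _ _ fh).
have -> : \sum_b hfield X w (w' b * Y b f) = \sum_b hfield X w (w' b) * Y b f +
    (\sum_b w' b * X (Y b f) + \sum_b \sum_c w' b * w c * Y c (Y b f)).
  rewrite -!big_split; apply: eq_bigr => b _ /=.
  rewrite (fieldM _ _ fh); congr (_ + _).
  rewrite [hfield X w (Y b f)]/hfield mulrDr mulr_sumr; congr (_ + _).
  by apply: eq_bigr => c _; rewrite mulrA.
rewrite [hfield X w (X' f)]/hfield; under eq_bigr do rewrite -XY'.
ring.
Qed.

(** Second order terms in the [Y b] cancel by symmetry. For D_i and D_j the remaining coefficients
    are D_i v_j^b - D_j v_i^b, the curvature of the connection. *)
Lemma hfield_bracket X X' w w' f : field X -> (forall b f, X (Y b f) = Y b (X f)) ->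
  field X' -> (forall b f, X' (Y b f) = Y b (X' f)) ->
  hfield X w (hfield X' w' f) - hfield X' w' (hfield X w f) = X (X' f) - X' (X f) +
  \sum_b (hfield X w (w' b) - hfield X' w' (w b)) * Y b f.
Proof.
move=> fX XY fX' XY'; rewrite !hfield2 // [X in _ - (_ + X)]exchange_big /=.
have -> : \sum_c \sum_b w b * w' c * Y c (Y b f) = \sum_b \sum_c w' b * w c * Y c (Y b f).
  by apply: eq_bigr => b _; apply: eq_bigr => c _; rewrite YC (mulrC (w c)).
have -> : \sum_b (hfield X w (w' b) - hfield X' w' (w b)) * Y b f =
    \sum_b hfield X w (w' b) * Y b f - \sum_b hfield X' w' (w b) * Y b f.
  by rewrite -sumrB; apply: eq_bigr => b _; rewrite mulrBl.
ring.
Qed.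

End HorizontalFields.

End Fields.

Lemma fld_split (n m : nat) (J : choiceType) (A : coordRing (coordinate n m J)) (f : A) :
  exists2 s : seq J, uniq s /\ (forall k, k \notin s -> pd (inr k) f = 0) &
  forall c, fld c f = \sum_(b : base n m) c (inl b) * pd (inl b) f +
    \sum_(k <- s) c (inr k) * pd (inr k) f.
Proof.
pose sJ := pmap (fun k : coordinate n m J => if k is inr j then Some j else None) (supp f).
have sJ_in j : (j \in sJ) = (inr j \in supp f).
  rewrite mem_pmap; apply/mapP/idP => [[[b|k] // ks [->//]]|js].
  by exists (inr j).
exists (undup sJ).
  split; first exact: undup_uniq.
  by move=> k; rewrite mem_undup sJ_in; exact: suppP.
move=> c; rewrite (@fldE _ _ _ _ ([seq inl b | b <- index_enum (base n m)] ++
   [seq inr k | k <- undup sJ])).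
- by rewrite big_cat !big_map.
- rewrite cat_uniq !map_inj_uniq ?undup_uniq ?index_enum_uniq /=; try by move=> ? ? [].
  by rewrite andbT; apply/hasPn => _ /mapP[k _ ->]; apply/mapP => -[].
- case=> [b|k]; rewrite mem_cat negb_or => /andP[].
    by move/mapP => H; case: H; exists b => //; exact: mem_index_enum.
  move=> _ H; apply: suppP; apply: contra H => ks.
  by apply/mapP; exists k => //; rewrite mem_undup sJ_in.
Qed.

(** * The ring of smooth functions on a chart *)

Section SmoothFunctionRing.
Variables (R : realType) (n m : nat) (U : set 'rV[R]_n) (openU : open U).
Variable J : choiceType.
Local Notation K := (coordinate n m J).
Local Notation cs := (cspace R n m J).
Local Notation chart := (@over_chart R n m U J).
Implicit Types (p q : cs) (k l : K) (G : cs -> R).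

(** Restricting to the chart makes equality in the ring blind to the values of a global
    representative elsewhere. *)
Definition chart_function : Type := set_type chart -> R.
HB.instance Definition _ := GRing.ComPzRing.on chart_function.

(** The proof of openness is a phantom argument, from which the subring structure can recover the
    fact that its closure properties rest on. *)
Definition smooth_on_chart of open U : pred chart_function :=
  fun g => `[< exists2 G : cs -> R, smooth U G & forall x : set_type chart, g x = G (val x) >].

Lemma smooth_on_chart_subring : subring_closed (smooth_on_chart openU).
Proof.
split.
- apply/asboolP; exists (cst 1) => //; exact: smooth_cst.
- move=> f g /asboolP[F sF EF] /asboolP[G sG EG]; apply/asboolP.
  exists (fun p => F p + (-1) * G p).
    apply: (smoothD openU sF); apply: (smoothM openU _ sG); exact: (smooth_cst _ openU).
  by move=> p; rewrite mulN1r -EF -EG.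
- move=> f g /asboolP[F sF EF] /asboolP[G sG EG]; apply/asboolP.
  exists (fun p => F p * G p); first exact: (smoothM openU sF sG).
  by move=> p; rewrite -EF -EG.
Qed.

HB.instance Definition _ := GRing.isSubringClosed.Build chart_function
  (smooth_on_chart openU) smooth_on_chart_subring.

Definition Cinf := {g : chart_function | smooth_on_chart openU g}.
HB.instance Definition _ := SubChoice.on Cinf.
HB.instance Definition _ := GRing.SubChoice_isSubComPzRing.Build chart_function
  (smooth_on_chart openU) Cinf smooth_on_chart_subring.
Implicit Types f g : Cinf.

Lemma rep_subproof f :
  exists G : cs -> R, smooth U G /\ forall x : set_type chart, val f x = G (val x).
Proof. by case: f => g /= /asboolP[G sG E]; exists G. Qed.

Definition rep f : cs -> R := projT1 (cid (rep_subproof f)).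

Lemma rep_smooth f : smooth U (rep f).
Proof. exact: (proj1 (projT2 (cid (rep_subproof f)))). Qed.

Lemma valE f p (cp : p \in chart) : val f (exist _ p cp) = rep f p.
Proof. exact: (proj2 (projT2 (cid (rep_subproof f)))). Qed.

Lemma Cinf_eq f g : (forall p, chart p -> rep f p = rep g p) -> f = g.
Proof.
move=> E; apply: val_inj; apply/funext => -[p cp].
by rewrite !valE E //; rewrite inE in cp.
Qed.

Lemma mkC_subproof G : smooth U G -> smooth_on_chart openU (fun x : set_type chart => G (val x)).
Proof. by move=> sG; apply/asboolP; exists G. Qed.

Definition mkC G (sG : smooth U G) : Cinf := Sub _ (mkC_subproof sG).

Lemma rep_mkC G (sG : smooth U G) p : chart p -> rep (mkC sG) p = G p.
Proof. by move=> cp; rewrite -(valE _ (mem_set cp)). Qed.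

Lemma repB f g p : chart p -> rep (f - g) p = rep f p - rep g p.
Proof. by move=> cp; rewrite -!(valE _ (mem_set cp)). Qed.
Lemma repD f g p : chart p -> rep (f + g) p = rep f p + rep g p.
Proof. by move=> cp; rewrite -!(valE _ (mem_set cp)). Qed.
Lemma repM f g p : chart p -> rep (f * g) p = rep f p * rep g p.
Proof. by move=> cp; rewrite -!(valE _ (mem_set cp)). Qed.
Lemma rep0 p : chart p -> rep 0 p = 0.
Proof. by move=> cp; rewrite -!(valE _ (mem_set cp)). Qed.
Lemma rep1 p : chart p -> rep 1 p = 1.
Proof. by move=> cp; rewrite -!(valE _ (mem_set cp)). Qed.
Lemma rep_bool (b : bool) p : chart p -> rep b%:R p = b%:R.
Proof. by case: b; [exact: rep1|exact: rep0]. Qed.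
Lemma rep_sum (I : Type) (r : seq I) (F : I -> Cinf) p : chart p ->
  rep (\sum_(i <- r) F i) p = \sum_(i <- r) rep (F i) p.
Proof.
move=> cp; elim: r => [|i r IH]; first by rewrite !big_nil rep0.
by rewrite !big_cons repD // IH.
Qed.

Definition Cpd k f : Cinf := mkC (smooth_partial openU k (rep_smooth f)).
Definition Ccoord k : Cinf := mkC (smooth_coord openU k).

Lemma rep_Cpd k f p : chart p -> rep (Cpd k f) p = partial k (rep f) p.
Proof. exact: rep_mkC. Qed.

Lemma rep_Ccoord k p : chart p -> rep (Ccoord k) p = p k.
Proof. exact: rep_mkC. Qed.

Lemma rep_Cpd_mkC k G (sG : smooth U G) p : chart p ->
  rep (Cpd k (mkC sG)) p = partial k G p.
Proof.
by move=> cp; rewrite rep_Cpd //; apply: (eq_partial openU) => // q cq; exact: rep_mkC.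
Qed.

Lemma partial_is_derive k G G' p : chart p ->
  is_derive (p k) 1 (fun t : R => G (along p k t)) (G' p) -> partial k G p = G' p.
Proof. by move=> cp [_ E]; rewrite /partial derive1E. Qed.

Lemma Cpd_zmod_morphism k : zmod_morphism (Cpd k).
Proof.
move=> f g; apply: Cinf_eq => p cp.
rewrite repB // !rep_Cpd // -(@eq_partial _ _ _ _ openU _ (fun q => rep f q - rep g q)) //.
  apply: (@partial_is_derive k _ (fun p => partial k (rep f) p - partial k (rep g) p)) => //.
  exact: (is_deriveB (smooth_is_derive k (rep_smooth f) cp) (smooth_is_derive k (rep_smooth g) cp)).
by move=> q cq; rewrite repB.
Qed.

Lemma CpdM k f g : Cpd k (f * g) = Cpd k f * g + f * Cpd k g.
Proof.
apply: Cinf_eq => p cp.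
rewrite repD // !repM // !rep_Cpd // -(@eq_partial _ _ _ _ openU _ (fun q => rep f q * rep g q)) //.
  apply: (@partial_is_derive k _ (fun p =>
    partial k (rep f) p * rep g p + rep f p * partial k (rep g) p)) => //.
  have D := is_deriveM (smooth_is_derive k (rep_smooth f) cp)
    (smooth_is_derive k (rep_smooth g) cp).
  rewrite along_id in D; apply: is_derive_eq D _.
  by rewrite addrC; congr (_ + _); rewrite /GRing.scale /= mulrC.
by move=> q cq; rewrite repM.
Qed.

Lemma Cpd_Ccoord k l : Cpd k (Ccoord l) = (k == l)%:R.
Proof.
apply: Cinf_eq => p cp; rewrite rep_Cpd_mkC // rep_bool //.
apply: (@partial_is_derive k _ (fun=> (k == l)%:R)) => //.
have [->|kl] := eqVneq k l.
  rewrite (_ : (fun t => _) = id); first exact: is_derive_id.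
  by apply/funext => t; rewrite along_at.
rewrite (_ : (fun t => _) = cst (p l)); first exact: (is_derive_cst (p l)).
by apply/funext => t; rewrite along_neq // eq_sym.
Qed.

Lemma CpdC k l f : Cpd k (Cpd l f) = Cpd l (Cpd k f).
Proof.
apply: Cinf_eq => p cp; rewrite /Cpd.
rewrite (rep_Cpd_mkC k (smooth_partial openU l (rep_smooth f)) cp).
rewrite (rep_Cpd_mkC l (smooth_partial openU k (rep_smooth f)) cp).
exact: (clairaut openU l k (rep_smooth f) cp).
Qed.

Lemma Cpd_supp f : exists s : seq K, forall k, k \notin s -> Cpd k f = 0.
Proof.
have [s _ Hs] := smooth_supp (rep_smooth f); exists s => k ks.
by apply: Cinf_eq => p cp; rewrite rep_Cpd // rep0 //; exact: (partial_eq0 openU Hs).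
Qed.

Definition Cring : coordRing K := CoordRing Cpd_zmod_morphism CpdM Cpd_Ccoord CpdC Cpd_supp.

End SmoothFunctionRing.
(** * The equation in special coordinates *)

Section FlatConnectionAlgebra.
Variables (n m : nat).
Local Notation K := (coordinate n m (spvar n m)).
Variable A : coordRing K.
Implicit Types (f g u : A) (h : 'I_m -> A) (S : A -> A) (a b : 'I_m) (i j : 'I_n).
Implicit Types (B : midx 'I_m) (I : midx 'I_n).
Local Notation m0 := (mnull 'I_m).
Local Notation unit_idx i := (mincr (mnull 'I_n) i).

Definition xz i : A := cz A (inl (inl i)).
Definition vz a : A := cz A (inl (inr a)).
(* The coordinate v_I^{a,B}, with the junk value 0 for |I| = 0. *)
Definition w a B I : A :=
  if insub I is Some I' then cz A (inr (a, B, I')) else 0.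

Lemma wE a B (I : {I : midx 'I_n | (0 < msize I)%N}) :
  w a B (val I) = cz A (inr (a, B, I)).
Proof. by rewrite /w valK. Qed.

Lemma w_unit_gt0 I i : (0 < msize (mincr I i))%N.
Proof. by rewrite msize_incr. Qed.

Definition dv_coef b (k : K) : A :=
  match k with
  | inl (inl _) => 0
  | inl (inr a) => (b == a)%:R
  | inr k => cz A (inr (k.1.1, mincr k.1.2 b, k.2))
  end.
Definition dv b : A -> A := fld (dv_coef b).
Lemma dv_field b : field (dv b). Proof. exact: fld_field. Qed.
HB.instance Definition _ b := GRing.isZmodMorphism.Build A A (dv b)
  (fld_zmod_morphism (dv_coef b)).

Lemma dv_x b i : dv b (xz i) = 0. Proof. exact: fld_cz. Qed.
Lemma dv_v b a : dv b (vz a) = (b == a)%:R. Proof. exact: fld_cz. Qed.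
Lemma dv_w b a B I : dv b (w a B I) = w a (mincr B b) I.
Proof. by rewrite /w; case: insubP => [I' _ _|_]; [exact: fld_cz|exact: raddf0]. Qed.

Lemma coord_ind (P : A -> Prop) : (forall i, P (xz i)) -> (forall a, P (vz a)) ->
  (forall a B I, (0 < msize I)%N -> P (w a B I)) -> forall k, P (cz A k).
Proof.
move=> Px Pv Pw [[i|a]|[[a B] I]]; [exact: Px|exact: Pv|].
by rewrite -wE; apply: Pw; case: I.
Qed.

Lemma field_coord_eq0 S : field S -> (forall i, S (xz i) = 0) ->
  (forall a, S (vz a) = 0) ->
  (forall a B I, (0 < msize I)%N -> S (w a B I) = 0) -> forall f, S f = 0.
Proof. by move=> fS Sx Sv Sw; exact/(field_eq0 fS)/(@coord_ind (fun f => S f = 0)). Qed.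

Lemma field_coord_comm S Z : field S -> field Z ->
  (forall i, S (Z (xz i)) = Z (S (xz i))) ->
  (forall a, S (Z (vz a)) = Z (S (vz a))) ->
  (forall a B I, (0 < msize I)%N -> S (Z (w a B I)) = Z (S (w a B I))) ->
  forall f, S (Z f) = Z (S f).
Proof.
move=> fS fZ Ex Ev Ew f; apply/eqP; rewrite -subr_eq0; apply/eqP.
apply: (field_coord_eq0 (field_bracket fS fZ)) => [i|a|a B I I0]; apply/eqP;
  by rewrite subr_eq0 ?Ex ?Ev ?Ew.
Qed.

Lemma dvC a b f : dv a (dv b f) = dv b (dv a f).
Proof.
apply: field_coord_comm => [||i|c|c B I _]; try exact: dv_field.
- by rewrite !dv_x !raddf0.
- by rewrite !dv_v !(field_bool _ (dv_field _)).
- by rewrite !dv_w mincrC.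
Qed.

Definition mdvS := mcompS dvC.

Lemma mdv_zmod_morphism B : zmod_morphism (mcomp dv B).
Proof.
move=> f g; elim/midx_ind: B => [|B b IH]; first by rewrite !mcomp0.
by rewrite !mdvS IH raddfB.
Qed.
HB.instance Definition _ B := GRing.isZmodMorphism.Build A A (mcomp dv B)
  (mdv_zmod_morphism B).

Lemma mdv_w a B I : mcomp dv B (w a m0 I) = w a B I.
Proof.
elim/midx_ind: B => [|B b IH]; first by rewrite mcomp0.
by rewrite mdvS IH dv_w.
Qed.

Definition dx_coef i (k : K) : A :=
  match k with
  | inl (inl j) => (i == j)%:R
  | inl (inr _) => 0
  | inr k => mcomp dv k.1.2 (w k.1.1 m0 (mincr (val k.2) i) -
      \sum_b w b m0 (unit_idx i) * w k.1.1 (mincr m0 b) (val k.2))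
  end.
Definition dx i : A -> A := fld (dx_coef i).
Lemma dx_field i : field (dx i). Proof. exact: fld_field. Qed.
HB.instance Definition _ i := GRing.isZmodMorphism.Build A A (dx i)
  (fld_zmod_morphism (dx_coef i)).

Lemma dx_x i j : dx i (xz j) = (i == j)%:R. Proof. exact: fld_cz. Qed.
Lemma dx_v i a : dx i (vz a) = 0. Proof. exact: fld_cz. Qed.
Lemma dx_w i a B I : (0 < msize I)%N -> dx i (w a B I) =
  mcomp dv B (w a m0 (mincr I i) -
    \sum_b w b m0 (unit_idx i) * w a (mincr m0 b) I).
Proof.
by move=> I0; rewrite [in LHS]/w insubT /= /dx fld_cz.
Qed.

Lemma dx_dv i b f : dx i (dv b f) = dv b (dx i f).
Proof.
apply: field_coord_comm => [||j|c|c B I I0]; [exact: dx_field|exact: dv_field|..].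
- by rewrite dv_x dx_x raddf0 (field_bool _ (dv_field _)).
- by rewrite dv_v dx_v raddf0 (field_bool _ (dx_field _)).
- by rewrite dv_w !dx_w // mdvS.
Qed.

Lemma field_dv_eq0 S : field S -> (forall b f, S (dv b f) = dv b (S f)) ->
  (forall i, S (xz i) = 0) -> (forall a, S (vz a) = 0) ->
  (forall a I, (0 < msize I)%N -> S (w a m0 I) = 0) -> forall f, S f = 0.
Proof.
move=> fS Sdv Sx Sv Sw; apply: field_coord_eq0 => // a B I I0.
by rewrite -mdv_w (mcomp_morph Sdv) Sw // raddf0.
Qed.

Definition dd i : A -> A := hfield dv (dx i) (fun b => w b m0 (unit_idx i)).

Lemma ddE i f : dd i f = dx i f + \sum_b w b m0 (unit_idx i) * dv b f.
Proof. by []. Qed.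

Lemma dd_field i : field (dd i).
Proof. by apply: hfield_field; [exact: dv_field|exact: dx_field]. Qed.

Lemma dd_x i j : dd i (xz j) = (i == j)%:R.
Proof. by rewrite ddE dx_x big1 ?addr0 // => b _; rewrite dv_x mulr0. Qed.

Lemma dd_v i a : dd i (vz a) = w a m0 (unit_idx i).
Proof.
rewrite ddE dx_v add0r (bigD1 a) //= dv_v eqxx mulr1 big1 ?addr0 // => b ba.
by rewrite dv_v (negbTE ba) mulr0.
Qed.

Lemma dd_w i a I : (0 < msize I)%N -> dd i (w a m0 I) = w a m0 (mincr I i).
Proof.
move=> I0; rewrite ddE dx_w // mcomp0.
by under [X in _ + X]eq_bigr do rewrite dv_w; rewrite subrK.
Qed.

Lemma dd_dv i b f : dv b (dd i f) =
  dd i (dv b f) + \sum_c dv b (w c m0 (unit_idx i)) * dv c f.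
Proof.
rewrite ddE (fieldD _ _ (dv_field b)) (field_sumr _ _ _ (dv_field b)) -dx_dv -addrA; congr (_ + _).
rewrite -big_split; apply: eq_bigr => c _ /=.
by rewrite (fieldM _ _ (dv_field b)) dvC addrC.
Qed.

Lemma dd_bracket i j f : dd i (dd j f) - dd j (dd i f) = dx i (dx j f) - dx j (dx i f).
Proof.
rewrite /dd hfield_bracket; first last.
- by move=> b g; exact: dx_dv.
- exact: dx_field.
- by move=> b g; exact: dx_dv.
- exact: dx_field.
- exact: dvC.
- exact: dv_field.
(* The coefficients are v_{ji}^b - v_{ij}^b, which vanish since multi-indices are unordered. *)
rewrite big1 ?addr0 // => b _.
by rewrite -/(dd i _) -/(dd j _) !dd_w ?w_unit_gt0 // mincrC subrr mul0r.
Qed.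

Lemma dxC i j f : dx i (dx j f) = dx j (dx i f).
Proof.
apply/eqP; rewrite -subr_eq0; apply/eqP.
apply: (field_dv_eq0 (field_bracket (dx_field i) (dx_field j))) => [b g|k|a|a I I0];
  rewrite /bracketA.
- by rewrite !dx_dv raddfB.
- by rewrite !dx_x !(field_bool _ (dx_field _)) subrr.
- by rewrite !dx_v !raddf0 addr0.
- by rewrite -dd_bracket !dd_w ?w_unit_gt0 // mincrC subrr.
Qed.

Lemma ddC i j f : dd i (dd j f) = dd j (dd i f).
Proof. by apply/eqP; rewrite -subr_eq0 dd_bracket dxC subrr. Qed.

Definition mddS := mcompS ddC.

Lemma mdd_v a I : (0 < msize I)%N -> mcomp dd I (vz a) = w a m0 I.
Proof.
elim/midx_ind: I => [|I i IH]; first by rewrite msize0.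
(* The first derivative is separate: it starts from v^a, which is not the value of [w] at the empty
   multi-index. *)
move=> _; rewrite mddS; have [I0|] := posnP (msize I); last first.
  by move=> I0; rewrite IH // dd_w.
suff -> : I = mnull _ by rewrite mcomp0 dd_v.
by elim/midx_ind: I I0 {IH} => // I k _; rewrite msize_incr.
Qed.

Definition dt (t : base n m) : A -> A := match t with inl i => dx i | inr a => dv a end.

Lemma dt_field t : field (dt t).
Proof. by case: t => [i|a]; [exact: dx_field|exact: dv_field]. Qed.

Lemma dtC t t' f : dt t (dt t' f) = dt t' (dt t f).
Proof.
by case: t => [i|a]; case: t' => [j|c] /=; [exact: dxC|exact: dx_dv|rewrite dx_dv|exact: dvC].
Qed.

Definition VA h f := \sum_a h a * dv a f.

Lemma VA_field h : field (VA h).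
Proof. by apply: field_lincomb => a; exact: dv_field. Qed.

Lemma VA_v h a : VA h (vz a) = h a.
Proof.
rewrite /VA (bigD1 a) //= dv_v eqxx mulr1 big1 ?addr0 // => b ba.
by rewrite dv_v (negbTE ba) mulr0.
Qed.

Lemma VA_x h i : VA h (xz i) = 0.
Proof. by rewrite /VA big1 // => a _; rewrite dv_x mulr0. Qed.

(* For S = S_h the right-hand side vanishes, so that S_h + V_h commutes with D_i. *)
Lemma SV_dd S h i f : field S -> (forall b g, S (dv b g) = dv b (S g)) ->
  S (dd i f) + VA h (dd i f) - dd i (S f + VA h f) =
  S (dx i f) - dx i (S f) +
  \sum_b (S (w b m0 (unit_idx i)) + VA h (w b m0 (unit_idx i)) - dd i (h b)) * dv b f.
Proof.
move=> fS Sdv.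
have ES : S (dd i f) = S (dx i f) +
    (\sum_b S (w b m0 (unit_idx i)) * dv b f + \sum_b w b m0 (unit_idx i) * dv b (S f)).
  rewrite ddE (fieldD _ _ fS) (field_sumr _ _ _ fS) -big_split; congr (_ + _).
  by apply: eq_bigr => b _; rewrite fieldM // Sdv.
have EV : VA h (dd i f) = \sum_a h a * dd i (dv a f) +
    \sum_b VA h (w b m0 (unit_idx i)) * dv b f.
  rewrite /VA; under eq_bigr do rewrite dd_dv mulrDr mulr_sumr.
  rewrite big_split /=; congr (_ + _); rewrite exchange_big; apply: eq_bigr => b _ /=.
  by rewrite mulr_suml; apply: eq_bigr => a _; rewrite mulrA.
have ED : dd i (VA h f) = \sum_a h a * dd i (dv a f) + \sum_a dd i (h a) * dv a f.
  rewrite /VA (field_sumr _ _ _ (dd_field i)) -big_split; apply: eq_bigr => a _ /=.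
  by rewrite (fieldM _ _ (dd_field i)) addrC.
rewrite (fieldD _ _ (dd_field i)) ES EV ED [dd i (S f)]ddE.
have -> : \sum_b (S (w b m0 (unit_idx i)) + VA h (w b m0 (unit_idx i)) - dd i (h b)) * dv b f =
   \sum_b S (w b m0 (unit_idx i)) * dv b f + \sum_b VA h (w b m0 (unit_idx i)) * dv b f
   - \sum_b dd i (h b) * dv b f.
  rewrite -big_split -sumrB; apply: eq_bigr => b _ /=; ring.
ring.
Qed.

Definition symA S := [/\ field S, forall i, S (xz i) = 0, forall a, S (vz a) = 0 &
  forall t f, S (dt t f) = dt t (S f)].

Definition is_SA h S := symA S /\
  forall i a, S (w a m0 (unit_idx i)) = dd i (h a) - VA h (w a m0 (unit_idx i)).

Lemma symA_dx S i f : symA S -> S (dx i f) = dx i (S f).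
Proof. by move=> [_ _ _ H]; exact: (H (inl i)). Qed.

Lemma symA_dv S b f : symA S -> S (dv b f) = dv b (S f).
Proof. by move=> [_ _ _ H]; exact: (H (inr b)). Qed.

Lemma is_SA_dd h S : is_SA h S ->
  forall i f, S (dd i f) + VA h (dd i f) = dd i (S f + VA h f).
Proof.
move=> [sS Sw] i f; apply/eqP; rewrite -subr_eq0 SV_dd; first last.
- by move=> b g; exact: symA_dv.
- by case: sS.
rewrite symA_dx // subrr add0r big1 // => b _.
by rewrite Sw subrK subrr mul0r.
Qed.

Lemma is_SA_w h S a B I : is_SA h S -> (0 < msize I)%N ->
  S (w a B I) = mcomp dv B (mcomp dd I (h a) - VA h (w a m0 I)).
Proof.
move=> hS I0; have [sS Sw] := hS.
rewrite -mdv_w (mcomp_morph (fun b g => symA_dv b g sS)); congr (mcomp dv B _).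
have := mcomp_morph (phi := fun f => S f + VA h f) (is_SA_dd hS) I (vz a).
rewrite mdd_v // VA_v; case: sS => _ _ -> _; rewrite add0r => <-.
by rewrite addrK.
Qed.

Lemma is_SA_uniq h S Z : is_SA h S -> is_SA h Z -> forall f, S f = Z f.
Proof.
move=> hS hZ; have [[fS Sx Sv _] _] := hS; have [[fZ Zx Zv _] _] := hZ.
apply: field_eq => //; apply: (@coord_ind (fun f => S f = Z f)) => [i|a|a B I I0].
- by rewrite Sx Zx.
- by rewrite Sv Zv.
- by rewrite (is_SA_w _ _ hS) // (is_SA_w _ _ hZ).
Qed.

Definition S_coef h (k : K) : A :=
  match k with
  | inl _ => 0
  | inr k => mcomp dv k.1.2 (mcomp dd (val k.2) (h k.1.1) - VA h (w k.1.1 m0 (val k.2)))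
  end.

Definition SA h : A -> A := fld (S_coef h).

Lemma SA_is_SA h : is_SA h (SA h).
Proof.
have fS : field (SA h) by exact: fld_field.
have Sx i : SA h (xz i) = 0 by exact: fld_cz.
have Sv a : SA h (vz a) = 0 by exact: fld_cz.
have Sw a B I : (0 < msize I)%N ->
    SA h (w a B I) = mcomp dv B (mcomp dd I (h a) - VA h (w a m0 I)).
  by move=> I0; rewrite [in LHS]/w insubT /= /SA fld_cz.
have Sdv b f : SA h (dv b f) = dv b (SA h f).
  apply: field_coord_comm => //; first exact: dv_field.
  - by move=> i; rewrite dv_x Sx raddf0 field0r.
  - by move=> a; rewrite dv_v Sv raddf0 field_bool.
  - by move=> a B I I0; rewrite dv_w !Sw // mdvS.
have Sw1 i a : SA h (w a m0 (unit_idx i)) = dd i (h a) - VA h (w a m0 (unit_idx i)).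
  by rewrite Sw ?w_unit_gt0 // mcomp0 mddS mcomp0.
(* The failure of S_h to commute with D_{x_i} is traded for that of Y_h with D_i, which on v_I^a is
   read off from Y_h v_I^a = D_I h^a. *)
have defect i f : SA h (dx i f) - dx i (SA h f) =
    SA h (dd i f) + VA h (dd i f) - dd i (SA h f + VA h f).
  rewrite SV_dd // [X in _ = _ + X]big1 ?addr0 // => b _.
  by rewrite Sw1 subrK subrr mul0r.
have Sdx i f : SA h (dx i f) = dx i (SA h f).
  apply/eqP; rewrite -subr_eq0; apply/eqP.
  apply: (field_dv_eq0 (field_bracket fS (dx_field i))) => [b g|j|a|a I I0];
    rewrite /bracketA.
  - by rewrite dx_dv !Sdv dx_dv raddfB.
  - by rewrite dx_x Sx raddf0 field_bool // subrr.
  - by rewrite dx_v Sv raddf0 field0r // subrr.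
  - by rewrite defect dd_w // !Sw ?w_unit_gt0 // !mcomp0 !subrK mddS subrr.
split => //; split => //; case => [i|b] f; [exact: Sdx|exact: Sdv].
Qed.

Definition bracketh (S Z : A -> A) h (h' : 'I_m -> A) a : A :=
  S (h' a) - Z (h a) + VA h (h' a) - VA h' (h a).

Lemma SA_bracket_is_SA h h' S Z : is_SA h S -> is_SA h' Z ->
  is_SA (bracketh S Z h h') (bracketA S Z).
Proof.
move=> hS hZ; have [sS Sw] := hS; have [sZ Zw] := hZ.
have [fS Sx Sv Sdt] := sS; have [fZ Zx Zv Zdt] := sZ.
set k := bracketh S Z h h'.
have SV S' h2 f : symA S' ->
    S' (VA h2 f) = \sum_a S' (h2 a) * dv a f + VA h2 (S' f).
  move=> sS'; have [fS' _ _ _] := sS'.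
  rewrite /VA (field_sumr _ _ _ fS') -big_split; apply: eq_bigr => a _ /=.
  by rewrite (fieldM _ _ fS') (symA_dv _ _ sS').
have VV h1 h2 f : VA h1 (VA h2 f) = \sum_a VA h1 (h2 a) * dv a f +
    \sum_a \sum_b h2 a * h1 b * dv b (dv a f).
  rewrite {2}/VA (field_sumr _ _ _ (VA_field h1)) -big_split; apply: eq_bigr => a _ /=.
  rewrite (fieldM _ _ (VA_field h1)); congr (_ + _).
  by rewrite /VA mulr_sumr; apply: eq_bigr => b _; rewrite mulrA.
pose Y f := S f + VA h f; pose Y' f := Z f + VA h' f.
have YY f : Y (Y' f) - Y' (Y f) = bracketA S Z f + VA k f.
  rewrite /Y /Y' (fieldD _ _ fS) (fieldD _ _ fZ) !(fieldD _ _ (VA_field _)).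
  rewrite (SV S h') // (SV Z h) // !VV [X in _ - (_ + (_ + (_ + X)))]exchange_big /=.
  have -> : \sum_j \sum_i h i * h' j * dv j (dv i f) =
            \sum_a \sum_b h' a * h b * dv b (dv a f).
    by apply: eq_bigr => a _; apply: eq_bigr => b _; rewrite dvC (mulrC (h b)).
  have -> : VA k f = \sum_a S (h' a) * dv a f - \sum_a Z (h a) * dv a f +
     \sum_a VA h (h' a) * dv a f - \sum_a VA h' (h a) * dv a f.
    by rewrite -sumrB -big_split -sumrB; apply: eq_bigr => a _ /=; rewrite /k /bracketh; ring.
  by rewrite /bracketA; ring.
have sB : symA (bracketA S Z).
  split; first exact: field_bracket.
  - by move=> i; rewrite /bracketA Sx Zx (field0r fS) (field0r fZ) subrr.
  - by move=> a; rewrite /bracketA Sv Zv (field0r fS) (field0r fZ) subrr.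
  - by move=> b f; rewrite /bracketA !(Sdt, Zdt) (fieldB _ _ (dt_field b)).
(* The generating section is found by writing v_i^a as D_i v^a and moving D_i out of [Y_f, Y_g],
   whose value at v^a is the bracket. *)
split => // i a; apply/eqP; rewrite eq_sym subr_eq; apply/eqP.
rewrite -YY /Y /Y' -dd_v.
rewrite !(is_SA_dd hS, is_SA_dd hZ) -(fieldB _ _ (dd_field i)).
have := YY (vz a); rewrite /Y /Y' => ->.
by case: sB => _ _ -> _; rewrite add0r VA_v.
Qed.

End FlatConnectionAlgebra.

(** * Injectivity of [h -> S_h] *)

Section Injectivity.
Variables (n m : nat).
Local Notation K := (coordinate n m (spvar n m)).
Variable A : coordRing K.
Implicit Types (f g u : A) (h : 'I_m -> A) (a b c : 'I_m) (i j : 'I_n).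
Implicit Types (B : midx 'I_m) (I : midx 'I_n) (N : nat) (k l : K).
Local Notation m0 := (mnull 'I_m).
Local Notation unit_idx i := (mincr (mnull 'I_n) i).

(** Only |I| is counted: D_{v^b} then preserves the order, and D_i raises it by one. Order 0 leaves
    exactly x and v. *)
Definition ord_of k : nat := match k with inl _ => 0 | inr k => msize (val k.2) end.

Definition order_le N f := forall k, (N < ord_of k)%N -> pd k f = 0.

Lemma order_leB N f g : order_le N f -> order_le N g -> order_le N (f - g).
Proof. by move=> Hf Hg k Nk; rewrite raddfB /= Hf // Hg // subrr. Qed.

Lemma order_leM N f g : order_le N f -> order_le N g -> order_le N (f * g).
Proof. by move=> Hf Hg k Nk; rewrite pdM Hf // Hg // mul0r mulr0 addr0. Qed.

Lemma order_le_sum N (T : Type) (r : seq T) (F : T -> A) :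
  (forall t, order_le N (F t)) -> order_le N (\sum_(t <- r) F t).
Proof. by move=> H k Nk; rewrite raddf_sum big1 // => t _; exact: H. Qed.

Lemma order_le_w N a B I : (msize I <= N)%N -> order_le N (w A a B I).
Proof.
move=> IN k Nk; rewrite /w; case: insubP => [I' _ E|_]; last exact: raddf0.
rewrite pd_cz; case: eqP => // kE; move: Nk; rewrite kE /= E => /leq_trans/(_ IN).
by rewrite ltnn.
Qed.

Lemma pd_fld k (d : K -> A) f :
  pd k (fld d f) = fld d (pd k f) + fld (fun l => pd k (d l)) f.
Proof.
have fd := fld_field d.
have := field_bracket (pd_field k) fd f; rewrite {1}/bracketA => E.
rewrite -(subrK (fld d (pd k f)) (pd k (fld d f))) E addrC; congr (_ + _).
apply: eq_fld => l; rewrite /bracketA fld_cz pd_cz field_bool ?subr0 //.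
Qed.

Lemma fld_eq0 (d : K -> A) f : (forall l, d l * pd l f = 0) -> fld d f = 0.
Proof. by move=> H; rewrite fld_supp big1. Qed.

Lemma order_le_dv N b f : order_le N f -> order_le N (dv b f).
Proof.
move=> Hf k Nk; rewrite pd_fld Hf // raddf0 add0r; apply: fld_eq0 => l.
have [lN|Nl] := leqP (ord_of l) N; last by rewrite Hf // mulr0.
case: l lN => [[i|a]|[[a B] I]] /= IN; rewrite ?raddf0 ?mul0r //.
  by rewrite (field_bool _ (pd_field k)) mul0r.
by rewrite -wE (order_le_w _ _ IN) ?mul0r.
Qed.

Lemma order_le_mdv N B f : order_le N f -> order_le N (mcomp (@dv n m A) B f).
Proof.
move=> Hf; elim/midx_ind: B => [|B b IH]; first by rewrite mcomp0.
by rewrite mdvS; exact: order_le_dv.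
Qed.

(** D_i does not commute with D_{v^B}; the remainder [r] collects the Leibniz terms in which
    derivatives fall on v_i^b, all of order at most |I|. *)
Lemma dd_wB i a B I : (0 < msize I)%N -> exists2 r : A,
  order_le (msize I) r & dd i (w A a B I) = w A a B (mincr I i) - r.
Proof.
move=> I0; have i1 b : order_le (msize I) (w A b m0 (unit_idx i)).
  by apply: order_le_w; rewrite msize_incr msize0.
exists (mcomp (@dv n m A) B (\sum_b w A b m0 (unit_idx i) * w A a (mincr m0 b) I) -
  \sum_b w A b m0 (unit_idx i) * w A a (mincr B b) I).
  by apply: order_leB; [apply: order_le_mdv|]; apply: order_le_sum => b;
    apply: order_leM => //; exact: order_le_w.
rewrite ddE dx_w // raddfB /= mdv_w opprB addrA addrAC; congr (_ - _ + _).
by apply: eq_bigr => b _; rewrite dv_w.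
Qed.

Lemma mincr_inj I I' i : mincr I i = mincr I' i -> I = I'.
Proof.
move=> /ffunP E; apply/ffunP => j; have := E j; rewrite !ffunE.
by move/eqP; rewrite eqn_add2r => /eqP.
Qed.

(** Comparison of leading terms: among the coordinates of order at most [N], only v_I^{a,B} has an
    image under D_i that involves v_{Ii}^{a,B}. *)
Lemma pd_dd N i f a B (I : {I : midx 'I_n | (0 < msize I)%N})
    (I' : {I : midx 'I_n | (0 < msize I)%N}) :
  order_le N f -> msize (val I) = N -> val I' = mincr (val I) i ->
  pd (inr (a, B, I')) (dd i f) = pd (inr (a, B, I)) f.
Proof.
move=> Hf IN I'E.
have I'N : msize (val I') = N.+1 by rewrite I'E msize_incr IN.
have N0 : (0 < N)%N by rewrite -IN; case: I {IN I'E}.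
have dd_fld g : dd i g = fld (fun l => dd i (cz A l)) g by exact: dd_field.
rewrite dd_fld pd_fld Hf /= ?I'N // raddf0 add0r (pd_field (inr (a, B, I)) f) !fld_supp.
apply: eq_bigr => l _.
have [lN|Nl] := leqP (ord_of l) N; last by rewrite Hf // !mulr0.
congr (_ * _); rewrite pd_cz; case: l lN => [[j|c]|[[c C] L]] /= LN.
- by rewrite -/(xz A j) dd_x (field_bool _ (pd_field _)).
- have i1 : (msize (unit_idx i) <= N)%N by rewrite msize_incr msize0.
  by rewrite -/(vz A c) dd_v (order_le_w _ _ i1) //= I'N.
- have L0 : (0 < msize (val L))%N by case: L {LN}.
  have [r Hr ddw] := dd_wB i c C L0; rewrite -wE ddw raddfB /= [X in _ - X]Hr; last first.
    by rewrite /= I'N ltnS.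
  rewrite subr0.
  have -> : w A c C (mincr (val L) i) =
      cz A (inr (c, C, Sub (mincr (val L) i) (w_unit_gt0 _ i))).
    by rewrite -wE SubK.
  rewrite pd_cz; congr (_%:R); congr nat_of_bool.
  apply/eqP/eqP => [[-> -> E]|[-> -> E]].
    congr (inr (_, _, _)); apply: val_inj; apply: (@mincr_inj _ _ i).
    by rewrite -I'E E SubK.
  by congr (inr (_, _, _)); apply: val_inj; rewrite SubK I'E E.
Qed.

Lemma order_le_exists h : exists N, forall a, order_le N (h a).
Proof.
exists (\max_(a : 'I_m) \max_(k <- supp (h a)) ord_of k) => a k Nk.
apply: suppP; apply: contraTN Nk => kh; rewrite -leqNgt.
apply: leq_trans (leq_bigmax a) => /=.
by rewrite (big_rem k) //= leq_maxl.
Qed.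

(** S_h v_i^a = 0 for one fixed direction [i]; this alone forces h = 0, and the existence of a
    direction is the condition n > 0. *)
Definition S_kernel i h := forall a, dd i (h a) = VA h (w A a m0 (unit_idx i)).

Lemma S_kernel_order_le N i h : S_kernel i h -> (forall a, order_le N (h a)) ->
  forall a, order_le 0 (h a).
Proof.
move=> kh; elim: N => // N IH HN; apply: IH => a k.
rewrite leq_eqVlt => /orP[/eqP kN|/HN //].
case: k kN => // [[[c C] L]] /= kN; symmetry in kN.
rewrite -(@pd_dd N.+1 i (h a) c C L (Sub (mincr (val L) i) (w_unit_gt0 _ i))) ?SubK //.
(* The factors v_i^{a,b} have order 1, at most [N.+1], whereas the derivative is taken in order
   [N.+2]. At order 0 this comparison fails, so the descent stops there. *)
rewrite kh; suff H : order_le N.+1 (VA h (w A a m0 (unit_idx i))).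
  by apply: H; rewrite /= msize_incr kN.
apply: order_le_sum => b; apply: order_leM => //; rewrite dv_w.
by apply: order_le_w; rewrite msize_incr msize0.
Qed.

Lemma S_kernel_eq0 i h : S_kernel i h -> forall a, h a = 0.
Proof.
move=> kh; have [N HN] := order_le_exists h.
have H0 := S_kernel_order_le kh HN.
move=> b.
(* The coordinate v_i^{b,b}. In the equation for h^b it is absent on the left, where order 0
   produces only v_i^c with empty upper index; on the right its coefficient is h^b. *)
pose k : K := inr (b, mincr m0 b, Sub (unit_idx i) (w_unit_gt0 _ i)).
have k1 : ord_of k = 1%N by rewrite /= msize_incr msize0.
have := kh b => /(congr1 (pd k)).
have dd_fld g : dd i g = fld (fun l => dd i (cz A l)) g by exact: dd_field.
rewrite dd_fld pd_fld (H0 _ k) ?k1 // raddf0 add0r fld_eq0; last first.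
  move=> l; have [l0|Nl] := leqP (ord_of l) 0; last by rewrite H0 // mulr0.
  case: l l0 => [[j|c]|[[c C] L]] /= L0.
  - by rewrite -/(xz A j) dd_x (field_bool _ (pd_field _)) mul0r.
  - rewrite -/(vz A c) dd_v /w insubT /= ?w_unit_gt0 // => I0; rewrite pd_cz.
    case: eqP => [[_ /ffunP /(_ b)]|_]; last by rewrite mul0r.
    by rewrite !ffunE eqxx.
  - by case: L L0 => L /= L0; rewrite leqNgt L0.
rewrite /VA raddf_sum (bigD1 b) //= big1 ?addr0 => [E|c cb].
  rewrite E pdM (H0 _ k) ?k1 // mul0r add0r dv_w /w insubT ?w_unit_gt0 // => I0.
  rewrite pd_cz (_ : k == _) ?mulr1 //; apply/eqP; congr (inr (_, _, _)).
  exact: val_inj.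
rewrite pdM (H0 _ k) ?k1 // mul0r add0r dv_w /w insubT ?w_unit_gt0 // => I0.
rewrite pd_cz; case: eqP => [[/ffunP /(_ c)]|_]; last by rewrite mulr0.
by rewrite !ffunE eqxx (negbTE cb).
Qed.

Lemma is_SA_inj h h' S : (0 < n)%N -> is_SA h S -> is_SA h' S -> forall a, h a = h' a.
Proof.
move=> n0 [_ H] [_ H'] a; apply/eqP; rewrite -subr_eq0; apply/eqP.
apply: (@S_kernel_eq0 (Ordinal n0) (fun a => h a - h' a)) => b.
have := H (Ordinal n0) b; rewrite H' => E.
rewrite (fieldB _ _ (dd_field _)).
have -> : VA (fun a => h a - h' a) (w A b m0 (unit_idx (Ordinal n0))) =
  VA h (w A b m0 (unit_idx (Ordinal n0))) - VA h' (w A b m0 (unit_idx (Ordinal n0))).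
  by rewrite /VA -sumrB; apply: eq_bigr => c _; rewrite mulrBl.
move/eqP: E; rewrite subr_eq => /eqP ->; ring.
Qed.

End Injectivity.

(** * Pullback along a change of coordinates *)

Section Pullback.
Variables (R : realType) (n m : nat) (U : set 'rV[R]_n) (openU : open U).
Variables J J' : choiceType.
Local Notation A := (Cring m openU J).
Local Notation A' := (Cring m openU J').
Local Notation chart := (@over_chart R n m U J).
Local Notation chart' := (@over_chart R n m U J').
Variable y : coordinate n m J' -> A.
Hypothesis ybase : forall b, y (inl b) = cz A (inl b).
Implicit Types (f g : A') (p : cspace R n m J).

Definition rep_map : cspace R n m J -> cspace R n m J' :=
  point_map (fun l => rep (y l)).

Let y_smooth l : smooth U (rep (y l)) := rep_smooth (y l).

Let y_rep_base (i : 'I_n) p : chart p -> rep (y (inl (inl i))) p = p (inl (inl i)).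
Proof. by move=> cp; rewrite ybase; exact: rep_Ccoord. Qed.

Lemma rep_map_chart p : chart p -> chart' (rep_map p).
Proof. exact: point_map_chart. Qed.

Definition pull f : A :=
  mkC openU (smooth_comp openU y_smooth y_rep_base (rep_smooth f)).

Lemma rep_pull f p : chart p -> rep (pull f) p = rep f (rep_map p).
Proof. by move=> cp; exact: rep_mkC. Qed.

Lemma pull_cz l : pull (cz A' l) = y l.
Proof.
apply: Cinf_eq => p cp; rewrite rep_pull //.
exact: (rep_Ccoord openU l (rep_map_chart cp)).
Qed.

Lemma pullB f g : pull (f - g) = pull f - pull g.
Proof.
apply: Cinf_eq => p cp; rewrite [RHS]repB // !rep_pull //.
exact: (repB _ _ (rep_map_chart cp)).
Qed.

Lemma pullD f g : pull (f + g) = pull f + pull g.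
Proof.
apply: Cinf_eq => p cp; rewrite [RHS]repD // !rep_pull //.
exact: (repD _ _ (rep_map_chart cp)).
Qed.

Lemma pullM f g : pull (f * g) = pull f * pull g.
Proof.
apply: Cinf_eq => p cp; rewrite [RHS]repM // !rep_pull //.
exact: (repM _ _ (rep_map_chart cp)).
Qed.

Lemma pull0 : pull 0 = 0.
Proof. by rewrite -{1}(subrr 0) pullB subrr. Qed.

Lemma pull_bool (b : bool) : pull b%:R = b%:R.
Proof.
case: b; last exact: pull0.
apply: Cinf_eq => p cp; rewrite [RHS]rep1 // rep_pull //.
exact: (rep1 openU (rep_map_chart cp)).
Qed.

Lemma pull_sum (I : Type) (r : seq I) (F : I -> A') :
  pull (\sum_(i <- r) F i) = \sum_(i <- r) pull (F i).
Proof. exact: (big_morph pull pullD pull0). Qed.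

Lemma pd_pull k f : pd k (pull f) =
  \sum_(l <- supp f) pull (pd l f) * pd k (y l).
Proof.
apply: Cinf_eq => p cp; rewrite rep_sum // rep_Cpd_mkC //.
have [s us Hs] := smooth_supp (rep_smooth f).
transitivity (\sum_(l <- s) partial l (rep f) (rep_map p) * partial k (rep (y l)) p).
  apply: (@partial_is_derive R n m U J k _ (fun p =>
    \sum_(l <- s) partial l (rep f) (rep_map p) * partial k (rep (y l)) p)) => //.
  exact: (chain_rule openU y_smooth y_rep_base k (rep_smooth f) us Hs cp).
have cp' := rep_map_chart cp.
rewrite (big_uniq_support us (supp_uniq f)).
- apply: eq_bigr => l _; rewrite repM // rep_pull //.
  by rewrite (rep_Cpd l f cp') (rep_Cpd k (y l) cp).
- by move=> l ls; rewrite (partial_eq0 openU Hs cp' ls) mul0r.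
- move=> l /suppP lf; rewrite -(rep_Cpd l f cp').
  by have -> : Cpd l f = 0 := lf; rewrite rep0 // mul0r.
Qed.

Lemma pull_field (X : A -> A) f : field X ->
  X (pull f) = \sum_(l <- supp f) pull (pd l f) * X (y l).
Proof.
move=> fX.
have [s us H] := fld_common (pull f :: [seq y l | l <- supp f]).
rewrite fX H ?mem_head //.
under eq_bigr do rewrite pd_pull mulr_sumr.
rewrite exchange_big /= big_seq [RHS]big_seq; apply: eq_bigr => l lf.
rewrite [X (y l)]fX H ?in_cons ?map_f ?orbT // mulr_sumr.
by apply: eq_bigr => k _; rewrite mulrCA.
Qed.

(** Both sides expand by the chain rule into values on coordinates, so that relatedness of fields is
    checked there. *)
Lemma pull_intertwine (X : A -> A) (X' : A' -> A') : field X -> field X' ->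
  (forall l, X (y l) = pull (X' (cz A' l))) -> forall f, X (pull f) = pull (X' f).
Proof.
move=> fX fX' E f; rewrite (pull_field f fX) [X' f]fX' fld_supp pull_sum.
by apply: eq_bigr => l _; rewrite pullM E mulrC.
Qed.

End Pullback.

Section FiniteSums.
Variables (R : realType) (n m : nat) (U : set 'rV[R]_n) (openU : open U).
Variables J : choiceType.
Local Notation A := (Cring m openU J).
Local Notation chart := (@over_chart R n m U J).

Lemma fsum_seq (T : choiceType) (F : T -> R) (s : seq T) : uniq s ->
  (forall k, k \notin s -> F k = 0) -> \sum_(k \in [set: T]) F k = \sum_(k <- s) F k.
Proof.
move=> us H; rewrite -(fsbig_widen [set` s] setT) //.
  by rewrite -fsbig_seq.
by move=> k /= [_ ks]; apply: H; apply/negP.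
Qed.

(** Links the finitely supported sums over all coordinates in the definitions to [fld]. *)
Lemma fsum_partial (f : A) (c : coordinate n m J -> R) (d : coordinate n m J -> A) p :
  chart p -> (forall k, rep (d k) p = c k) ->
  \sum_(k \in [set: coordinate n m J]) c k * partial k (rep f) p = rep (fld d f) p.
Proof.
move=> cp E; rewrite fld_supp rep_sum // (@fsum_seq _ _ (supp f)) ?supp_uniq //.
  by apply: eq_bigr => k _; rewrite repM // E (@rep_Cpd _ _ _ _ openU).
move=> k /suppP kf; rewrite -(@rep_Cpd _ _ _ _ openU) //.
by have -> : Cpd k f = 0 := kf; rewrite rep0 // mulr0.
Qed.

Lemma fsum_partial_inr (f : A) (c : J -> R) (d : coordinate n m J -> A) p :
  chart p -> (forall k, rep (d (inr k)) p = c k) ->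
  \sum_(b : base n m) rep (d (inl b)) p * partial (inl b) (rep f) p +
  \sum_(k \in [set: J]) c k * partial (inr k) (rep f) p = rep (fld d f) p.
Proof.
move=> cp E; have [s [us Hs] ->] := fld_split f.
rewrite repD // !rep_sum //; congr (_ + _).
  by apply: eq_bigr => b _; rewrite repM // (@rep_Cpd _ _ _ _ openU).
rewrite (fsum_seq us).
  by apply: eq_bigr => k _; rewrite repM // E (@rep_Cpd _ _ _ _ openU).
move=> k /Hs kf; rewrite -(@rep_Cpd _ _ _ _ openU) //.
by have -> : Cpd (inr k) f = 0 := kf; rewrite rep0 // mulr0.
Qed.

End FiniteSums.
(** * Jets and special coordinates *)

Section Prolongation.
Variables (R : realType) (n m : nat) (U : set 'rV[R]_n) (openU : open U).
Local Notation B := (base n m).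
Local Notation AJ := (Cring m openU (jetvar n m)).
Local Notation AW := (Cring m openU (spvar n m)).
Local Notation jets := (cspace R n m (jetvar n m)).
Local Notation chartJ := (@over_chart R n m U (jetvar n m)).
Local Notation chartW := (@over_chart R n m U (spvar n m)).
Local Notation fc := (@fc_set R n m U).
Implicit Types (f g : AJ) (H : AW) (p : jets) (i j : 'I_n) (a b : 'I_m) (t : B).

Definition jc i a (s : midx B) : AJ := cz AJ (inr (i, a, s)).

Definition jt_coef t (k : coordinate n m (jetvar n m)) : AJ :=
  match k with
  | inl t' => (t == t')%:R
  | inr k => jc k.1.1 k.1.2 (mincr k.2 t)
  end.
Definition jt t : AJ -> AJ := fld (jt_coef t).
Lemma jt_field t : field (jt t). Proof. exact: fld_field. Qed.
HB.instance Definition _ t := GRing.isZmodMorphism.Build AJ AJ (jt t)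
  (fld_zmod_morphism (jt_coef t)).

Lemma jt_base t t' : jt t (cz AJ (inl t')) = (t == t')%:R.
Proof. exact: fld_cz. Qed.
Lemma jt_jc t i a s : jt t (jc i a s) = jc i a (mincr s t).
Proof. exact: fld_cz. Qed.

Lemma jtC t t' f : jt t (jt t' f) = jt t' (jt t f).
Proof.
apply/eqP; rewrite -subr_eq0; apply/eqP.
apply: (field_eq0 (field_bracket (jt_field t) (jt_field t'))) => -[u|[[i a] s]].
  by rewrite /bracketA !jt_base !(field_bool _ (jt_field _)) subrr.
by rewrite /bracketA -/(jc i a s) !jt_jc mincrC subrr.
Qed.

Definition mjtS := mcompS jtC.

Lemma jtotal_rep t G f : (forall p, chartJ p -> G p = rep f p) ->
  forall p, chartJ p -> jtotal t G p = rep (jt t f) p.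
Proof.
move=> E p cp; rewrite /jtotal (eq_partial openU _ cp E).
rewrite /jt -(fsum_partial_inr f (c := fun k => jvar k.1.1 k.1.2 (mincr k.2 t) p)) //.
  congr (_ + _); last by apply: eq_fsbigr => k _; rewrite (eq_partial openU _ cp E).
  rewrite (bigD1 t) //= eqxx rep1 // mul1r big1 ?addr0 // => t' /negbTE tt'.
  by rewrite eq_sym tt' rep0 // mul0r.
by move=> k; rewrite /= /jc rep_Ccoord.
Qed.

Lemma mcomp_jtotal_rep s G f : (forall p, chartJ p -> G p = rep f p) ->
  forall p, chartJ p -> mcomp (@jtotal R n m) s G p = rep (mcomp jt s f) p.
Proof.
apply: (mcomp_rel (rel := fun G f => forall p, chartJ p -> G p = rep f p)).
by move=> t G' f'; exact: jtotal_rep.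
Qed.

Local Notation jv := (fun b : 'I_m => jt (inr b)).

Definition jdd i : AJ -> AJ := hfield jv (jt (inl i)) (fun b => jc i b (mnull B)).

Lemma jdd_field i : field (jdd i).
Proof. by apply: hfield_field => *; exact: jt_field. Qed.
HB.instance Definition _ i := GRing.isZmodMorphism.Build AJ AJ (jdd i)
  (fun f g => fieldB f g (jdd_field i)).

Definition jF i j a : AJ := jdd i (jc j a (mnull B)) - jdd j (jc i a (mnull B)).

Lemma fc_eqn_rep i j a p : chartJ p -> fc_eqn i j a p = rep (jF i j a) p.
Proof.
move=> cp; rewrite repB //.
have E i' j' : fc_lhs i' j' a p = rep (jdd i' (jc j' a (mnull B))) p.
  rewrite /fc_lhs /jdd /hfield repD // rep_sum // jt_jc /jc rep_Ccoord //; congr (_ + _).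
  by apply: eq_bigr => b _; rewrite repM // -/(jc j' a _) jt_jc /jc !rep_Ccoord.
by rewrite /fc_eqn !E.
Qed.

Lemma fc_chart p : fc p -> chartJ p. Proof. by case. Qed.

(** Defined by vanishing on the equation together with all total derivatives, instead of by
    generators: stability under [jt] is then immediate. *)
Definition ideal f := forall s p, fc p -> rep (mcomp jt s f) p = 0.

Lemma mjt_zmod_morphism s : zmod_morphism (mcomp jt s).
Proof.
move=> f g; elim/midx_ind: s => [|s t IH]; first by rewrite !mcomp0.
by rewrite !mjtS IH raddfB.
Qed.

Lemma mjt0 s : mcomp jt s 0 = 0.
Proof. by rewrite -{1}(subrr 0) mjt_zmod_morphism subrr. Qed.

Lemma mjtD s f g : mcomp jt s (f + g) = mcomp jt s f + mcomp jt s g.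
Proof. by rewrite -{1}[g]opprK -[- g]sub0r !mjt_zmod_morphism mjt0 sub0r opprK. Qed.

Lemma ideal0 : ideal 0.
Proof. by move=> s p /fc_chart cp; rewrite mjt0 rep0. Qed.

Lemma idealB f g : ideal f -> ideal g -> ideal (f - g).
Proof.
by move=> If Ig s p fp; rewrite mjt_zmod_morphism repB ?If ?Ig ?subrr //; exact: fc_chart.
Qed.

Lemma idealN f : ideal f -> ideal (- f).
Proof. by move=> If; rewrite -sub0r; apply: idealB => //; exact: ideal0. Qed.

Lemma idealD f g : ideal f -> ideal g -> ideal (f + g).
Proof. by move=> If Ig; rewrite -[g]opprK; apply: idealB => //; exact: idealN. Qed.

Lemma ideal_sum (I : Type) (r : seq I) (F : I -> AJ) :
  (forall x, ideal (F x)) -> ideal (\sum_(i <- r) F i).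
Proof. by move=> IF; apply: big_ind => //; [exact: ideal0|exact: idealD]. Qed.

Lemma mjt_jt s t f : mcomp jt s (jt t f) = mcomp jt (mincr s t) f.
Proof. by rewrite mjtS; symmetry; apply: mcomp_morph => t' g; exact: jtC. Qed.

Lemma ideal_jt t f : ideal f -> ideal (jt t f).
Proof. by move=> If s p fp; rewrite mjt_jt If. Qed.

Lemma idealM f g : ideal f -> ideal (f * g).
Proof.
(* Both functions are generalized, as the Leibniz rule sends the derivative to either factor. *)
move=> + s; elim/midx_ind: s f g => [|s t IH] f g If p fp.
  by have := If (mnull _) p fp; rewrite !mcomp0 repM => [->|]; rewrite ?mul0r //; exact: fc_chart.
rewrite -mjt_jt (fieldM _ _ (jt_field t)) mjtD repD; last exact: fc_chart.
by rewrite !IH ?addr0 //; exact: ideal_jt.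
Qed.

Lemma ideal_jF i j a : ideal (jF i j a).
Proof.
have lt i' j' : (i' < j')%N -> ideal (jF i' j' a).
  move=> ij s p fp; case: (fp) => cp /(_ i' j' a s ij) <-.
  symmetry; apply: mcomp_jtotal_rep cp => q cq; exact: fc_eqn_rep.
(* The equation is imposed for i < j; antisymmetry of [jF] supplies the remaining cases. *)
have [ij|ji|/val_inj ->] := ltngtP i j; first exact: lt.
  by rewrite /jF -opprB; apply: idealN; exact: lt.
by rewrite /jF subrr; exact: ideal0.
Qed.

Definition cong f g := ideal (f - g).

Lemma cong_refl f : cong f f. Proof. by rewrite /cong subrr; exact: ideal0. Qed.
Lemma cong_sym f g : cong f g -> cong g f.
Proof. by rewrite /cong -[g - f]opprB; exact: idealN. Qed.
Lemma cong_trans f g h : cong f g -> cong g h -> cong f h.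
Proof. by move=> fg gh; have := idealD fg gh; rewrite addrA subrK. Qed.
Lemma cong_jt t f g : cong f g -> cong (jt t f) (jt t g).
Proof. by move=> /(ideal_jt t); rewrite raddfB. Qed.
Lemma cong_B f f' g g' : cong f f' -> cong g g' -> cong (f - g) (f' - g').
Proof.
move=> If Ig; rewrite /cong (_ : _ - _ - _ = (f - f') - (g - g')); last by ring.
exact: idealB.
Qed.

Lemma cong_jdd i f g : cong f g -> cong (jdd i f) (jdd i g).
Proof.
move=> fg; rewrite /cong -raddfB /jdd /= /hfield; apply: idealD; first exact: ideal_jt.
by apply: ideal_sum => b; rewrite mulrC; apply: idealM; exact: ideal_jt.
Qed.

Lemma cong_jdd_comm i j f : cong (jdd i (jdd j f)) (jdd j (jdd i f)).
Proof.
rewrite /cong hfield_bracket; try by [move=> *; exact: jt_field|move=> *; exact: jtC].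
rewrite jtC subrr add0r; apply: ideal_sum => b; apply: idealM; exact: ideal_jF.
Qed.

Lemma cong_mjddS (I : midx 'I_n) i f :
  cong (mcomp jdd (mincr I i) f) (jdd i (mcomp jdd I f)).
Proof.
apply: (mcompS_rel (rel := cong)).
- exact: cong_refl.
- exact: cong_trans.
- by move=> k; exact: cong_jdd.
- by move=> k l; exact: cong_jdd_comm.
Qed.

Lemma jvC a b f : jt (inr a) (jt (inr b) f) = jt (inr b) (jt (inr a) f).
Proof. exact: jtC. Qed.

(* [ysig] and [ypsi] induce mutually inverse parametrizations of the equation:
   special coordinates through jets, and jets through special coordinates. *)
Definition ysig (k : coordinate n m (spvar n m)) : AJ :=
  match k with
  | inl t => cz AJ (inl t)
  | inr k => mcomp jv k.1.2 (mcomp jdd (val k.2) (cz AJ (inl (inr k.1.1))))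
  end.
Lemma ysig_base t : ysig (inl t) = cz AJ (inl t). Proof. by []. Qed.
Definition sig : AW -> AJ := pull ysig_base.

Definition ypsi (k : coordinate n m (jetvar n m)) : AW :=
  match k with
  | inl t => cz AW (inl t)
  | inr k => mcomp (@dt n m AW) k.2 (w AW k.1.2 (mnull 'I_m) (mincr (mnull 'I_n) k.1.1))
  end.
Lemma ypsi_base t : ypsi (inl t) = cz AW (inl t). Proof. by []. Qed.
Definition psi : AJ -> AW := pull ypsi_base.

Lemma psi_jc i a s : psi (jc i a s) =
  mcomp (@dt n m AW) s (w AW a (mnull 'I_m) (mincr (mnull 'I_n) i)).
Proof. exact: (pull_cz ypsi_base). Qed.

(** An exact identity: a jet of v_i^a is sent to the same derivatives of v_i^a on W, and there all
    total derivatives commute. *)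
Lemma psi_jt t f : psi (jt t f) = dt t (psi f).
Proof.
symmetry; apply: pull_intertwine; [exact: dt_field|exact: jt_field|].
case=> [t'|[[i a] s]].
  rewrite jt_base pull_bool; case: t => [i|a]; case: t' => [j|c] /=.
  - exact: (dx_x AW i j).
  - exact: (dx_v AW i c).
  - exact: (dv_x AW a j).
  - exact: (dv_v AW a c).
rewrite -/(jc i a s) jt_jc /jc (pull_cz ypsi_base) /=.
by rewrite (mcompS (@dtC n m AW)).
Qed.

Lemma psi_jdd i f : psi (jdd i f) = dd i (psi f).
Proof.
rewrite /jdd /hfield /psi pullD pull_sum -/psi psi_jt ddE; congr (_ + _).
by apply: eq_bigr => b _; rewrite /psi pullM -/psi psi_jt psi_jc mcomp0.
Qed.

Lemma psi_jF i j a : psi (jF i j a) = 0.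
Proof.
rewrite /jF /psi pullB -/psi !psi_jdd !psi_jc !mcomp0 !dd_w ?w_unit_gt0 //.
by rewrite mincrC subrr.
Qed.

Lemma psi_ysig k : psi (ysig k) = cz AW k.
Proof.
case: k => [t|[[a A] I]]; first exact: (pull_cz ypsi_base).
rewrite /= (mcomp_morph (D' := @dv n m AW)); last by move=> b f; exact: psi_jt.
rewrite (mcomp_morph psi_jdd) /psi (pull_cz ypsi_base).
have -> : ypsi (inl (inr a)) = vz AW a by [].
have I0 : (0 < msize (val I))%N by case: I.
by rewrite mdd_v // mdv_w; exact: (wE AW a A I).
Qed.

Lemma sig_w a A (I : midx 'I_n) : (0 < msize I)%N -> sig (w AW a A I) =
  mcomp jv A (mcomp jdd I (cz AJ (inl (inr a)))).
Proof. by move=> I0; rewrite /w insubT /= /sig (pull_cz ysig_base). Qed.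

Lemma jdd_v i a : jdd i (cz AJ (inl (inr a))) = jc i a (mnull B).
Proof.
rewrite /jdd /hfield jt_base /= add0r (bigD1 a) //= jt_base eqxx mulr1.
rewrite big1 ?addr0 // => b /negbTE ba.
by rewrite jt_base (_ : inr b == inr a = false) ?mulr0.
Qed.

Lemma sig_w1 i a : sig (w AW a (mnull 'I_m) (mincr (mnull 'I_n) i)) = jc i a (mnull B).
Proof. by rewrite sig_w ?w_unit_gt0 // mcomp0 mcomp1 jdd_v. Qed.

Lemma jv_sig b H : jt (inr b) (sig H) = sig (dv b H).
Proof.
apply: pull_intertwine; [exact: jt_field|exact: dv_field|].
case=> [[i|a]|[[a A] I]].
- by rewrite -/(xz AW i) dv_x pull0 jt_base.
- by rewrite -/(vz AW a) dv_v pull_bool jt_base.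
- rewrite -wE dv_w -/sig sig_w; last by case: I.
  by rewrite (mcompS jvC).
Qed.

Lemma cong_mjv A f g : cong f g -> cong (mcomp jv A f) (mcomp jv A g).
Proof. by apply: (mcomp_rel (rel := cong)) => b x y; exact: cong_jt. Qed.

(** For D_{v^b} this is an equality. For D_{x_i} one writes D_{x_i} = D_i - sum_b v_i^b D_{v^b} on
    jets; appending [i] to [I] then costs a reordering of the D_j, legitimate modulo the ideal
    only. *)
Lemma jt_sig_coord t k : cong (jt t (ysig k)) (sig (dt t (cz AW k))).
Proof.
case: t => [i|b]; last first.
  by rewrite -(pull_cz ysig_base) -/sig jv_sig; exact: cong_refl.
case: k => [[j|a]|[[a A] I]].
- rewrite -/(xz AW j) /= dx_x jt_base /sig pull_bool; exact: cong_refl.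
- rewrite -/(vz AW a) /= dx_v jt_base /sig pull0; exact: cong_refl.
have I0 : (0 < msize (val I))%N by case: I.
rewrite -wE /= dx_w //; set v := cz AJ _.
rewrite (mcomp_morph (phi := jt (inl i)) (D' := jv)); last by move=> b f; exact: jtC.
have -> : sig (mcomp (@dv n m AW) A (w AW a (mnull 'I_m) (mincr (val I) i) -
    \sum_b w AW b (mnull 'I_m) (mincr (mnull 'I_n) i) * w AW a (mincr (mnull 'I_m) b) (val I))) =
  mcomp jv A (sig (w AW a (mnull 'I_m) (mincr (val I) i) -
    \sum_b w AW b (mnull 'I_m) (mincr (mnull 'I_n) i) * w AW a (mincr (mnull 'I_m) b) (val I))).
  by apply: mcomp_morph => b H; rewrite jv_sig.
apply: cong_mjv.
have -> : jt (inl i) (mcomp jdd (val I) v) = jdd i (mcomp jdd (val I) v) -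
    \sum_b jc i b (mnull B) * jt (inr b) (mcomp jdd (val I) v).
  by rewrite /jdd /hfield addrK.
rewrite /sig pullB pull_sum -/sig; apply: cong_B.
  rewrite sig_w ?w_unit_gt0 // mcomp0; apply: cong_sym; exact: cong_mjddS.
have -> : \sum_b sig (w AW b (mnull 'I_m) (mincr (mnull 'I_n) i) *
    w AW a (mincr (mnull 'I_m) b) (val I)) =
  \sum_b jc i b (mnull B) * jt (inr b) (mcomp jdd (val I) v).
  apply: eq_bigr => b _; rewrite /sig pullM -/sig sig_w1 sig_w //.
  by rewrite (mcomp1 jv).
exact: cong_refl.
Qed.

Lemma jt_sig t H : cong (jt t (sig H)) (sig (dt t H)).
Proof.
rewrite /cong (pull_field ysig_base _ (jt_field t)) [dt t H]dt_field fld_supp /sig pull_sum -sumrB.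
apply: ideal_sum => l; rewrite pullM [X in _ - X]mulrC -mulrBr mulrC; apply: idealM.
exact: jt_sig_coord.
Qed.

(** Every jet coordinate is recovered from special coordinates modulo the ideal, by differentiating
    v_i^a; evaluated on the equation, this becomes [SigK]. *)
Lemma jc_sig_psi i a s : cong (jc i a s) (sig (psi (jc i a s))).
Proof.
elim/midx_ind: s => [|s t IH].
  by rewrite psi_jc mcomp0 sig_w1; exact: cong_refl.
rewrite -jt_jc psi_jt; apply: cong_trans (jt_sig t _); exact: cong_jt.
Qed.

Definition Psi : cspace R n m (spvar n m) -> jets := rep_map ypsi.
Definition Sig : jets -> cspace R n m (spvar n m) := rep_map ysig.

Lemma rep_psi f q : chartW q -> rep (psi f) q = rep f (Psi q).
Proof. exact: rep_pull. Qed.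
Lemma rep_sig H p : chartJ p -> rep (sig H) p = rep H (Sig p).
Proof. exact: rep_pull. Qed.
Lemma Psi_chart q : chartW q -> chartJ (Psi q).
Proof. exact: (rep_map_chart ypsi_base). Qed.
Lemma Sig_chart p : chartJ p -> chartW (Sig p).
Proof. exact: (rep_map_chart ysig_base). Qed.

(** Differential consequences of the equation pull back to derivatives of [psi (jF i j a)], which is
    0. *)
Lemma Psi_fc q : chartW q -> fc (Psi q).
Proof.
move=> cq; have cp := Psi_chart cq; split => // i j a s _.
rewrite (mcomp_jtotal_rep s (f := jF i j a)) //; last by move=> p; exact: fc_eqn_rep.
rewrite -rep_psi // (mcomp_morph (D' := @dt n m AW)); last by move=> t f; exact: psi_jt.
rewrite psi_jF (_ : mcomp _ s 0 = 0) ?rep0 //.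
elim/midx_ind: s => [|s t IH]; first by rewrite mcomp0.
by rewrite (mcompS (@dtC n m AW)) IH (field0r (dt_field t)).
Qed.

Lemma PsiK q : chartW q -> Sig (Psi q) = q.
Proof.
move=> cq; apply/funext => k.
by rewrite /Sig /rep_map /point_map -rep_psi // psi_ysig; exact: rep_Ccoord.
Qed.

Lemma SigK p : fc p -> Psi (Sig p) = p.
Proof.
move=> fp; have cp := fc_chart fp; apply/funext => k.
rewrite /Psi /rep_map /point_map -rep_sig //.
case: k => [t|[[i a] s]].
  by rewrite /= /sig (pull_cz ysig_base); exact: rep_Ccoord.
have := jc_sig_psi i a s => /(_ (mnull _) p fp); rewrite mcomp0 repB // psi_jc /=.
by move/eqP; rewrite subr_eq0 => /eqP <-; exact: rep_Ccoord.
Qed.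

End Prolongation.
(** * Operators on the equation *)

Section Transfer.
Variables (R : realType) (n m : nat) (U : set 'rV[R]_n) (openU : open U).
Local Notation B := (base n m).
Local Notation AJ := (Cring m openU (jetvar n m)).
Local Notation AW := (Cring m openU (spvar n m)).
Local Notation chartW := (@over_chart R n m U (spvar n m)).
Local Notation E := (Efc m U).
Local Notation m0 := (mnull 'I_m).
Local Notation unit_idx i := (mincr (mnull 'I_n) i).
Implicit Types (H : AW) (e : E) (g : fun_on_E m U) (i : 'I_n) (a b : 'I_m).
Implicit Types (X S : operator m U) (h : vecfun m U).

Lemma E_fc e : fc_set U (val e).
Proof. exact: (set_mem (valP e)). Qed.

Lemma E_chart e : chartW (Sig openU (val e)).
Proof. by apply: Sig_chart; exact: fc_chart (E_fc e). Qed.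

(** Functions on W read on the equation through the special coordinates: injective, with image the
    functions satisfying [smoothE]. *)
Definition theta H : fun_on_E m U := fun e => rep H (Sig openU (val e)).

Definition Psi_E q (cq : chartW q) : E := SigSub (mem_set (Psi_fc openU cq)).

Lemma theta_Psi H q (cq : chartW q) : theta H (Psi_E cq) = rep H q.
Proof. by rewrite /theta /= PsiK. Qed.

Lemma theta_inj H H' : theta H = theta H' -> H = H'.
Proof.
by move=> EH; apply: Cinf_eq => q cq; rewrite -!(theta_Psi _ cq) EH.
Qed.

Lemma thetaD H H' e : theta (H + H') e = theta H e + theta H' e.
Proof. apply: repD; exact: E_chart. Qed.
Lemma thetaB H H' e : theta (H - H') e = theta H e - theta H' e.
Proof. apply: repB; exact: E_chart. Qed.
Lemma thetaM H H' e : theta (H * H') e = theta H e * theta H' e.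
Proof. apply: repM; exact: E_chart. Qed.
Lemma theta_sum (I : Type) (r : seq I) (F : I -> AW) e :
  theta (\sum_(x <- r) F x) e = \sum_(x <- r) theta (F x) e.
Proof. apply: rep_sum; exact: E_chart. Qed.
Lemma theta0 : theta 0 = cst 0.
Proof. by apply/funext => e; apply: rep0; exact: E_chart. Qed.
Lemma theta_psi (f : AJ) e : theta (psi f) e = rep f (val e).
Proof. by rewrite /theta rep_psi ?SigK //; [exact: E_fc|exact: E_chart]. Qed.

Lemma restr_theta G (sG : smooth U G) : restr G = theta (psi (mkC openU sG)).
Proof.
apply/funext => e; rewrite theta_psi (rep_mkC openU sG) //.
exact: fc_chart (E_fc e).
Qed.

Lemma theta_restr H : theta H = restr (rep (sig H)).
Proof.
by apply/funext => e; rewrite /theta /restr rep_sig //; exact: fc_chart (E_fc e).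
Qed.

Lemma smoothE_theta H : smoothE (theta H).
Proof. by exists (rep (sig H)); split; [exact: rep_smooth|rewrite theta_restr]. Qed.

Lemma smoothE_ex g : smoothE g -> exists H, g = theta H.
Proof. by move=> [G [sG <-]]; rewrite (restr_theta sG); eexists. Qed.

Lemma smooth_vecfun_ex h : smooth_vecfun h -> exists h' : 'I_m -> AW,
  h = fun a => theta (h' a).
Proof.
move=> sh; have /choice[h' Hh'] : forall a, exists H, h a = theta H.
  by move=> a; exact/smoothE_ex/sh.
by exists h'; apply/funext.
Qed.

(** Whichever smooth extension is chosen, [psi] sends it to [H]; as [psi] intertwines the total
    derivatives, these are tangent to the equation. *)
Lemma totalE_theta (t : B) H : totalE t (theta H) = theta (dt t H).
Proof.
have [sG EG] : smooth U (extend (theta H)) /\ restr (extend (theta H)) = theta H.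
  by rewrite /extend; case: xgetP => [G -> //|/(_ (rep (sig H)))[]];
    split; [exact: rep_smooth|rewrite theta_restr].
have HE : H = psi (mkC openU sG) by apply: theta_inj; rewrite -restr_theta.
rewrite [in RHS]HE -psi_jt; apply/funext => e; rewrite theta_psi /totalE /restr.
apply: jtotal_rep; last exact: fc_chart (E_fc e).
by move=> p cp; rewrite (rep_mkC openU sG cp).
Qed.

Lemma base_theta (t : B) : restr (jbase t) = theta (cz AW (inl t)).
Proof.
apply/funext => e; rewrite /theta (rep_Ccoord openU _ (E_chart e)).
rewrite /Sig /rep_map /point_map /= /restr /jbase.
by rewrite (rep_Ccoord openU _ (fc_chart (E_fc e))).
Qed.

Lemma xE_theta i : xE i = theta (xz AW i). Proof. exact: base_theta. Qed.
Lemma vE_theta a : vE a = theta (vz AW a). Proof. exact: base_theta. Qed.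

Lemma viE_theta i a : viE i a = theta (w AW a m0 (unit_idx i)).
Proof.
apply/funext => e; rewrite -(mcomp0 (@dt n m AW) (w _ _ _ _)) -psi_jc theta_psi.
by rewrite (rep_Ccoord openU _ (fc_chart (E_fc e))).
Qed.

Lemma Dv_theta a H : Dv a (theta H) = theta (dv a H).
Proof. exact: totalE_theta. Qed.
Lemma Dx_theta i H : Dx i (theta H) = theta (dx i H).
Proof. exact: totalE_theta. Qed.

Lemma D_theta i H : D i (theta H) = theta (dd i H).
Proof.
apply/funext => e; rewrite /D ddE thetaD theta_sum Dx_theta; congr (_ + _).
by apply: eq_bigr => b _; rewrite thetaM viE_theta Dv_theta.
Qed.

Lemma V_theta h (h' : 'I_m -> AW) H : (forall a, h a = theta (h' a)) ->
  V_ h (theta H) = theta (VA h' H).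
Proof.
move=> Eh; apply/funext => e; rewrite /V_ /VA theta_sum.
by apply: eq_bigr => a _; rewrite thetaM Eh Dv_theta.
Qed.

Lemma v_sp_theta a (A : midx 'I_m) (I : midx 'I_n) :
  v_sp a A I = theta (mcomp (@dv n m AW) A (mcomp (@dd n m AW) I (vz AW a))).
Proof.
rewrite (mcomp_morph (D' := @Dv R n m U)); last by move=> b H; rewrite Dv_theta.
rewrite (mcomp_morph (D' := @D R n m U)); last by move=> i H; rewrite D_theta.
by rewrite -vE_theta.
Qed.

Lemma v_of_theta (k : spvar n m) : v_of k = theta (cz AW (inr k)).
Proof.
case: k => [[a A] I]; have I0 : (0 < msize (val I))%N by case: I.
rewrite /v_of v_sp_theta; congr theta.
transitivity (w AW a A (val I)); last exact: wE AW a A I.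
by rewrite -mdv_w -mdd_v.
Qed.

Definition transfers X (X' : AW -> AW) := forall H, X (theta H) = theta (X' H).

Lemma psi_sig H : psi (sig H) = H.
Proof.
apply: Cinf_eq => q cq; rewrite rep_psi // rep_sig; last exact: Psi_chart.
by rewrite PsiK.
Qed.

Lemma psi_sum (I : Type) (r : seq I) (F : I -> AJ) :
  psi (\sum_(x <- r) F x) = \sum_(x <- r) psi (F x).
Proof. exact: pull_sum. Qed.

Lemma psiM (f g : AJ) : psi (f * g) = psi f * psi g. Proof. exact: pullM. Qed.

(** The coefficients on the equation are extended to jets by [sig]; the resulting field is applied
    to each special coordinate as a function of jets, and [psi] brings the result back to W. *)
Lemma vector_field_transfers X : vector_field X ->
  exists2 X' : AW -> AW, field X' & transfers X X'.
Proof.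
move=> [c [sc Xc]].
have /choice[c' Hc'] : forall k, exists H, c k = theta H by move=> k; exact/smoothE_ex/sc.
pose d k : AJ := sig (c' k).
exists (fld (fun l => psi (fld d (ysig openU l)))); first exact: fld_field.
move=> H; apply/funext => e; have ce := fc_chart (E_fc e).
rewrite theta_restr Xc; last exact: rep_smooth.
rewrite (@fsum_partial R n m U openU _ (sig H) _ d) //; last by move=> k; rewrite rep_sig // Hc'.
rewrite -theta_psi; congr (theta _ e).
rewrite (pull_field (ysig_base openU) _ (fld_field d)) psi_sum fld_supp.
by apply: eq_bigr => l _; rewrite psiM -/(sig _) psi_sig mulrC.
Qed.

Lemma transfers_vector_field X (X' : AW -> AW) : field X' -> transfers X X' -> vector_field X.
Proof.
move=> fX' XX'; exists (fun k => theta (X' (ypsi openU k))); split.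
  by move=> k; exact: smoothE_theta.
move=> G sG e; have ce := fc_chart (E_fc e).
pose f : AJ := mkC openU sG.
have pdE k : partial k G (val e) = theta (psi (pd k f)) e.
  rewrite theta_psi (rep_Cpd k f ce); apply: (eq_partial openU _ ce) => p cp.
  by rewrite (rep_mkC openU sG cp).
rewrite (restr_theta sG) XX' -/f (pull_field (ypsi_base openU) _ fX') theta_sum.
rewrite (fsum_seq (supp_uniq f)).
  by apply: eq_bigr => k _; rewrite thetaM pdE mulrC.
move=> k /suppP kf; rewrite pdE kf (_ : psi 0 = 0) ?theta0 ?mulr0 //.
exact: pull0.
Qed.

Lemma symmetry_transfers S : symmetry S -> exists2 S' : AW -> AW, symA S' & transfers S S'.
Proof.
move=> [vS Sx Sv St]; have [S' fS' SS'] := vector_field_transfers vS.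
exists S' => //; split => // [i|a|t H]; apply: theta_inj; rewrite -?SS'.
- by rewrite -xE_theta Sx theta0.
- by rewrite -vE_theta Sv theta0.
- rewrite -!totalE_theta -SS' St //; exact: smoothE_theta.
Qed.

Lemma transfers_symmetry S (S' : AW -> AW) : symA S' -> transfers S S' -> symmetry S.
Proof.
move=> [fS' Sx Sv St] SS'; split.
- exact: transfers_vector_field fS' SS'.
- by move=> i; rewrite xE_theta SS' Sx theta0.
- by move=> a; rewrite vE_theta SS' Sv theta0.
- by move=> t g /smoothE_ex[H ->]; rewrite totalE_theta !SS' totalE_theta St.
Qed.

Lemma dd_VA (h' : 'I_m -> AW) i H : dd i (VA h' H) - VA h' (dd i H) =
  \sum_a (dd i (h' a) - VA h' (w AW a m0 (unit_idx i))) * dv a H.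
Proof.
have := @SV_dd n m AW (fun=> 0) h' i H (@field0 _ AW).
rewrite (field0r (dx_field i)) subrr !add0r => Eq.
rewrite -opprB [in LHS]Eq; last by move=> b f; rewrite (field0r (dv_field b)).
by rewrite -sumrN; apply: eq_bigr => a _; rewrite add0r -mulNr opprB.
Qed.

Lemma FN_bracket_theta h (h' : 'I_m -> AW) X (X' : AW -> AW) H e :
  (forall a, h a = theta (h' a)) -> field X' -> transfers X X' ->
  FN_bracket (@U_fc R n m U) (V_ h) X (theta H) e =
  theta (\sum_i \sum_a (dd i (h' a) - VA h' (w AW a m0 (unit_idx i))) *
    X' (xz AW i) * dv a H) e.
Proof.
move=> Eh fX' XX'.
have UX H0 : U_fc X (theta H0) = theta (\sum_i X' (xz AW i) * dd i H0).
  apply/funext => e0; rewrite /U_fc theta_sum; apply: eq_bigr => i _.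
  by rewrite thetaM xE_theta XX' D_theta.
rewrite /FN_bracket /commutator (V_theta _ Eh) !UX (V_theta _ Eh).
(* V_h kills x_i, so [X, V_h] x_i = - V_h (X x_i). This cancels the derivatives of the coefficients
   X x_i in the commutator and leaves sum_i X(x_i) [D_i, V_h]. *)
have -> : U_fc (fun (g : fun_on_E m U) e => X (V_ h g) e - V_ h (X g) e) (theta H) e =
    - theta (\sum_i VA h' (X' (xz AW i)) * dd i H) e.
  rewrite /U_fc theta_sum -sumrN; apply: eq_bigr => i _.
  rewrite xE_theta (V_theta _ Eh) !XX' (V_theta _ Eh) VA_x (field0r fX') theta0 /=.
  by rewrite sub0r mulNr thetaM D_theta.
rewrite opprK -thetaB -thetaD; congr (theta _ e).
rewrite (field_sumr _ _ _ (VA_field h')) -sumrB -big_split; apply: eq_bigr => i _ /=.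
rewrite (fieldM _ _ (VA_field h')).
transitivity (X' (xz AW i) * (dd i (VA h' H) - VA h' (dd i H))); first by ring.
by rewrite dd_VA mulr_sumr; apply: eq_bigr => a _; ring.
Qed.

Lemma section_form_theta (phi : 'I_n -> 'I_m -> fun_on_E m U)
    (phi' : 'I_n -> 'I_m -> AW) X (X' : AW -> AW) H e :
  (forall i a, phi i a = theta (phi' i a)) -> transfers X X' ->
  section_form phi X (theta H) e =
  theta (\sum_i \sum_a phi' i a * X' (xz AW i) * dv a H) e.
Proof.
move=> Ephi XX'; rewrite /section_form theta_sum; apply: eq_bigr => i _.
rewrite theta_sum; apply: eq_bigr => a _.
by rewrite !thetaM Ephi xE_theta XX' Dv_theta.
Qed.

Lemma is_S_transfers h (h' : 'I_m -> AW) S : (forall a, h a = theta (h' a)) ->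
  is_S_ h S -> exists2 S' : AW -> AW, is_SA h' S' & transfers S S'.
Proof.
move=> Eh [sS FN]; have [S' sS' SS'] := symmetry_transfers sS.
exists S' => //; split => // i a; apply: theta_inj; apply/funext => e.
(* Contracting with D_{x_i} and applying to v^a isolates the component with indices [i] and [a]. *)
have := FN (Dx i) (transfers_vector_field (dx_field i) (Dx_theta i)) (vE a).
rewrite vE_theta => /(_ (smoothE_theta _))/(congr1 (@^~ e)).
rewrite (FN_bracket_theta _ _ Eh (dx_field i) (Dx_theta i)).
rewrite (section_form_theta (phi' := fun i a => S' (w AW a m0 (unit_idx i))) _ _ _ (Dx_theta i)).
  have pick (F : 'I_n -> 'I_m -> AW) :
      \sum_j \sum_b F j b * dx i (xz AW j) * dv b (vz AW a) = F i a.
    rewrite (bigD1 i) //= [X in _ + X]big1 ?addr0; last first.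
      move=> j /negbTE ji; rewrite big1 // => b _.
      by rewrite dx_x eq_sym ji mulr0 mul0r.
    rewrite (bigD1 a) //= [X in _ + X]big1 ?addr0; last first.
      by move=> b /negbTE ba; rewrite dv_v ba mulr0.
    by rewrite dx_x dv_v !eqxx !mulr1.
  by rewrite !pick.
by move=> j b; rewrite /generating_section viE_theta SS'.
Qed.

Lemma transfers_is_S h (h' : 'I_m -> AW) S (S' : AW -> AW) : (forall a, h a = theta (h' a)) ->
  is_SA h' S' -> transfers S S' -> is_S_ h S.
Proof.
move=> Eh [sS' Sw] SS'; split; first exact: transfers_symmetry sS' SS'.
move=> X /vector_field_transfers[X' fX' XX'] g /smoothE_ex[H ->].
apply/funext => e; rewrite (FN_bracket_theta _ _ Eh fX' XX').
rewrite (section_form_theta (phi' := fun i a => S' (w AW a m0 (unit_idx i))) _ _ _ XX').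
  congr (theta _ e); apply: eq_bigr => i _; apply: eq_bigr => a _.
  by rewrite Sw.
by move=> j b; rewrite /generating_section viE_theta SS'.
Qed.

(** Well defined by injectivity of [theta]; the value [cst 0] off smooth functions is a default that
    no condition on symmetries tests. *)
Definition transfer_op (X' : AW -> AW) : operator m U := fun g =>
  if pselect (exists H, g = theta H) is left ex then theta (X' (projT1 (cid ex))) else cst 0.

Lemma transfer_opP (X' : AW -> AW) : transfers (transfer_op X') X'.
Proof.
move=> H; rewrite /transfer_op; case: pselect => [ex|[]]; last by exists H.
by case: (cid ex) => H' /= /theta_inj <-.
Qed.

Lemma sp_point_Sig e : sp_point e = Sig openU (val e).
Proof.
apply/funext => -[t|k].
  by rewrite -[RHS](rep_Ccoord openU (inl t) (E_chart e)) -/(theta _ e) -base_theta.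
by rewrite -[RHS](rep_Ccoord openU (inr k) (E_chart e)) /= v_of_theta.
Qed.

(** The special coordinates reach every point over the chart, so the function chosen in [sp_partial]
    agrees there with [rep H]. *)
Lemma sp_partial_theta k H e :
  sp_partial k (theta H) e = partial (inr k) (rep H) (Sig openU (val e)).
Proof.
rewrite /sp_partial sp_point_Sig; apply: (eq_partial openU _ (E_chart e)) => q cq.
case: xgetP => [G -> [sG GE]|/(_ (rep H))[]].
  have := congr1 (@^~ (Psi_E cq)) GE; rewrite /= theta_Psi => <-.
  by rewrite sp_point_Sig /= PsiK.
split; first exact: rep_smooth.
by apply/funext => e0 /=; rewrite sp_point_Sig.
Qed.

End Transfer.

Theorem proposition8 (R : realType) (n m : nat) (U : set 'rV[R]_n)
    (openU : open U) :
  [/\ (* the symmetry S_h exists and is unique *)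
      forall h : vecfun m U, smooth_vecfun h ->
        exists S : operator m U, is_S_ h S /\
          forall S' : operator m U, is_S_ h S' ->
            forall g, smoothE g -> S' g = S g,
      (* the bracket determined by the commutator of symmetries *)
      forall (f g : vecfun m U) (Sf Sg : operator m U),
        smooth_vecfun f -> smooth_vecfun g -> is_S_ f Sf -> is_S_ g Sg ->
        [/\ smooth_vecfun (bracket Sf Sg f g),
            is_S_ (bracket Sf Sg f g) (commutator Sf Sg) &
            (0 < n)%N -> forall k : vecfun m U, smooth_vecfun k ->
              is_S_ k (commutator Sf Sg) -> k = bracket Sf Sg f g] &
      (* the coefficients of S_h in the special coordinates *)
      forall (h : vecfun m U) (S : operator m U),
        smooth_vecfun h -> is_S_ h S ->
        let c (a : 'I_m) (A : midx 'I_m) (I : midx 'I_n) : fun_on_E m U :=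
          S (v_sp a A I) in
        let zeta (i : 'I_n) (b : 'I_m) : fun_on_E m U :=
          c b (mnull 'I_m) (mincr (mnull 'I_n) i) in
        [/\ forall g, smoothE g -> forall e : Efc m U,
              S g e = \sum_(k \in [set: spvar n m])
                        c k.1.1 k.1.2 (val k.2) e * sp_partial k g e,
            forall (a : 'I_m) (A : midx 'I_m) (I : midx 'I_n),
              (0 < msize I)%N ->
              c a A I = mcomp (@Dv R n m U) A (c a (mnull 'I_m) I),
            forall (a : 'I_m) (I : midx 'I_n) (i : 'I_n), (0 < msize I)%N ->
              forall e : Efc m U,
              c a (mnull 'I_m) (mincr I i) e =
                D i (c a (mnull 'I_m) I) e +
                \sum_(b < m) v_sp a (mincr (mnull 'I_m) b) I e * zeta i b e &
            forall (i : 'I_n) (b : 'I_m) (e : Efc m U),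
              zeta i b e = D i (h b) e -
                \sum_(d < m) v_sp b (mincr (mnull 'I_m) d)
                               (mincr (mnull 'I_n) i) e * h d e]].
Proof.
split.
- move=> h /(smooth_vecfun_ex openU)[h' Eh].
  have {}Eh a : h a = theta (h' a) by rewrite Eh.
  exists (transfer_op (SA h')); split.
    exact: transfers_is_S Eh (SA_is_SA h') (transfer_opP _).
  move=> S' /(is_S_transfers Eh)[T hT S'T] g /(smoothE_ex openU)[H ->].
  by rewrite S'T transfer_opP (is_SA_uniq hT (SA_is_SA h')).
- move=> f g Sf Sg /(smooth_vecfun_ex openU)[f' Ef] /(smooth_vecfun_ex openU)[g' Eg].
  have {}Ef a : f a = theta (f' a) by rewrite Ef.
  have {}Eg a : g a = theta (g' a) by rewrite Eg.
  move=> /(is_S_transfers Ef)[Sf' hSf SfE] /(is_S_transfers Eg)[Sg' hSg SgE].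
  have Eb a : bracket Sf Sg f g a = theta (bracketh Sf' Sg' f' g' a).
    apply/funext => e; rewrite /bracket /bracketh !Ef !Eg SfE SgE.
    by rewrite (V_theta _ Ef) (V_theta _ Eg) thetaB thetaD thetaB.
  have Ec : transfers (commutator Sf Sg) (bracketA Sf' Sg').
    move=> H; apply/funext => e.
    by rewrite /commutator /bracketA SfE !SgE SfE thetaB.
  split.
  + by move=> a; rewrite Eb; exact: smoothE_theta.
  + exact: transfers_is_S Eb (SA_bracket_is_SA hSf hSg) Ec.
  + move=> n0 k /(smooth_vecfun_ex openU)[k' Ek].
    have {}Ek a : k a = theta (k' a) by rewrite Ek.
    move=> /(is_S_transfers Ek)[T hT TE].
    (* Both are transferred from the same commutator and [theta] is injective, so that [is_SA_inj]
       becomes applicable. *)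
    have TB : T = bracketA Sf' Sg'.
      by apply/funext => H; apply: theta_inj; rewrite -TE -Ec.
    rewrite TB in hT; apply/funext => a; rewrite Ek Eb.
    by rewrite (is_SA_inj n0 hT (SA_bracket_is_SA hSf hSg)).
- move=> h S /(smooth_vecfun_ex openU)[h' Eh].
  have {}Eh a : h a = theta (h' a) by rewrite Eh.
  move=> /(is_S_transfers Eh)[S' hS SE] c zeta.
  have [sS Sw] := hS; have [fS Sx Sv St] := sS.
  have cE a A I : c a A I = theta (S' (mcomp (@dv n m _) A (mcomp (@dd n m _) I (vz _ a)))).
    by rewrite /c (v_sp_theta openU) SE.
  have zetaE i b : zeta i b = theta (S' (w _ b (mnull 'I_m) (mincr (mnull 'I_n) i))).
    by rewrite /zeta cE mcomp0 mcomp1 dd_v.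
  split.
  + move=> g /(smoothE_ex openU)[H ->] e; rewrite SE.
    under eq_fsbigr do rewrite sp_partial_theta.
    have ce := E_chart openU e.
    rewrite /theta [S' H]fS -(fsum_partial_inr H
      (c := fun k => c k.1.1 k.1.2 (val k.2) e) ce); last first.
      by move=> k; rewrite /c -/(v_of k) (v_of_theta openU) SE.
    (* The components along x_i and v^a vanish, which leaves the sum over the v_I^{a,A}. *)
    rewrite big1 ?add0r // => -[i|a] _.
      by rewrite (Sx i) rep0 ?mul0r.
    by rewrite (Sv a) rep0 ?mul0r.
  + move=> a A I _; rewrite !cE mcomp0.
    rewrite (mcomp_morph (fun b f => symA_dv b f sS)).
    by apply: mcomp_morph => b H; rewrite Dv_theta.
  + move=> a I i _ e; rewrite !cE !mcomp0 mddS D_theta.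
    set u := mcomp _ I _.
    (* S commutes with D_{x_i} and D_{v^b} but not with D_i: the extra terms of the recursion come
       from S acting on the coefficients v_i^b of D_i. *)
    rewrite {1}ddE (fieldD _ _ fS) (field_sumr _ _ _ fS) (symA_dx _ _ sS).
    rewrite thetaD theta_sum ddE thetaD theta_sum -addrA -big_split; congr (_ + _).
    apply: eq_bigr => b _ /=.
    rewrite (fieldM _ _ fS) (symA_dv _ _ sS) thetaD !thetaM addrC; congr (_ + _).
    by rewrite zetaE (v_sp_theta openU) mcomp1 mulrC.
  + move=> i b e; rewrite zetaE Sw Eh D_theta thetaB; congr (_ - _).
    rewrite /VA theta_sum; apply: eq_bigr => d _.
    by rewrite thetaM (v_sp_theta openU) !mcomp1 dd_v Eh mulrC.
Qed.
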